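(* For any discrete memoryless channel $Q$ (in the asynchronous communication model described in the context), the synchronization threshold satisfies $$\alpha(Q)=\max_{x\in\mathcal X} D\big(Q(\cdot|x)\,\|\,Q(\cdot|\star)\big).$$ Furthermore, any asynchronism exponent $\alpha<\alpha(Q)$ can be achieved by a coding strategy (a sequence of codes, each with a sequential decoder, indexed by the blocklength $N$, with $M=M_N$ messages) that satisfies $\lim_{N\to\infty}\frac{\ln M}{N}>0$.
   Context: Model. A discrete memoryless channel has finite input alphabet $\mathcal X$, finite output alphabet $\mathcal Y$, transition probabilities $Q(y|x)$, and a distinguished ''noise'' input symbol $\star\in\mathcal X$. Standing assumptions: for every $y\in\mathcal Y$ there is $x\in\mathcal X$ with $Q(y|x)>0$, and the capacity $C(Q)$ of the (ordinary, synchronized) channel is strictly positive. A code consists of $M\ge 2$ equally likely messages, codewords $c^N(m)=(c_1(m),\dots,c_N(m))\in\mathcal X^N$, and a sequential decoder. The asynchronism level is an integer $A\ge 1$: the transmission start time $\nu$ is uniformly distributed on $\{1,\dots,A\}$, independent of the message. Given message $m$ and $\nu$, the outputs $Y_1,Y_2,\dots$ are independent with $Y_i\sim Q(\cdot|\star)$ if $i\le\nu-1$ or $i\ge\nu+N$, and $Y_i\sim Q(\cdot|c_{i-\nu+1}(m))$ if $\nu\le i\le \nu+N-1$. The receiver knows $A$ and the code but not $\nu$. A decoder is a pair $(\tau,\phi)$ where $\tau$ is a stopping time with respect to $Y_1,Y_2,\dots$ and $\phi$ is a function of $Y_1,\dots,Y_\tau$ returning a message. Let $\mathbb P_{m,l},\mathbb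 E_{m,l}$ denote probability and expectation given that message $m$ is sent starting at time $\nu=l$. Error probability: $\mathbb P(\mathcal E)=\frac1{AM}\sum_{m=1}^M\sum_{l=1}^A\mathbb P_{m,l}(\phi\ne m)$. Average delay: $\mathbb E(\tau-\nu)^+=\frac1{AM}\sum_{m=1}^M\sum_{l=1}^A\mathbb E_{m,l}(\tau-l)^+$, with $x^+=\max\{0,x\}$. Rate: $R=\ln M/\mathbb E(\tau-\nu)^+$ (natural logarithms). An asynchronism exponent $\alpha$ is achievable at rate $R$ if for every $\varepsilon>0$ there is a code with (sufficiently large) blocklength $N$ operating at asynchronism level $A=e^{(\alpha-\varepsilon)N}$ with rate at least $R-\varepsilon$ and $\mathbb P(\mathcal E)\le\varepsilon$. $\alpha(R,Q)$ is the supremum of asynchronism exponents achievable at rate $R$, and the synchronization threshold is $\alpha(Q)=\alpha(0,Q)$. $D(\cdot\|\cdot)$ denotes Kullback–Leibler divergence (which may be $+\infty$). *)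

(* Defs.v *)
From HB Require Import structures.
From mathcomp Require Import all_boot all_order all_algebra.
From mathcomp Require Import all_classical all_reals all_analysis.
Set Implicit Arguments. Unset Strict Implicit. Unset Printing Implicit Defensive.
Import Order.TTheory GRing.Theory Num.Theory.
Import numFieldNormedType.Exports.
Local Open Scope classical_set_scope.
Local Open Scope ring_scope.

(* A code with blocklength N and M messages, together with a sequential
   decoder: stop y = "stop after having observed the prefix y" (the stopping
   time tau is the first t >= 1 with stop (Y_1..Y_t)), and dec y = the decoded
   message when stopping after prefix y. *)
Record code (X Y : finType) (N M : nat) := Code {
  cw : 'I_M -> N.-tuple X;
  stop : seq Y -> bool;
  dec : seq Y -> 'I_M }.

Section Async.
Variables (R : realType) (X Y : finType) (Q : X -> Y -> R) (star : X).

Definition is_channel := (forall x y, 0 <= Q x y) /\ (forall x, \sum_y Q x y = 1).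

Definition out_dist (P : X -> R) (y : Y) : R := \sum_x P x * Q x y.
Definition mutual_info (P : X -> R) : R :=
  \sum_x \sum_y (if P x * Q x y == 0 then 0
                 else P x * Q x y * ln (Q x y / out_dist P y)).
Definition input_dists : set (X -> R) :=
  [set P | (forall x, 0 <= P x) /\ \sum_x P x = 1].
Definition capacity : R := sup [set mutual_info P | P in input_dists].

Definition KL (p q : Y -> R) : \bar R :=
  (\sum_y (if p y == 0%R then 0%E
           else if q y == 0%R then +oo%E else (p y * ln (p y / q y))%:E))%E.

Section Perf.
Variables (N M : nat) (C : code X Y N M).

(* channel input at (1-indexed) time i when the codeword w starts at time l *)
Definition inp (w : N.-tuple X) (l i : nat) : X :=
  if ((l <= i)%N && (i < l + N)%N) then nth star w (i - l) else star.

Definition pref_prob (m : 'I_M) (l t : nat) (y : t.-tuple Y) : R :=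
  \prod_(i < t) Q (inp (cw C m) l i.+1) (tnth y i).

Definition stops_at (t : nat) (y : t.-tuple Y) : bool :=
  [&& (0 < t)%N, stop C y & [forall s : 'I_t, (0 < s)%N ==> ~~ stop C (take s y)]].

Definition p_tau (m : 'I_M) (l t : nat) : R :=
  \sum_(y : t.-tuple Y | stops_at y) pref_prob m l y.

Definition p_correct (m : 'I_M) (l t : nat) : R :=
  \sum_(y : t.-tuple Y | stops_at y && (dec C y == m)) pref_prob m l y.

(* P_{m,l}(phi <> m); never stopping counts as an error *)
Definition p_err (m : 'I_M) (l : nat) : \bar R :=
  (1 - \sum_(t <oo) (p_correct m l t)%:E)%E.

(* E_{m,l} (tau - l)^+ ; +oo contribution from P(tau = oo) *)
Definition exp_delay (m : 'I_M) (l : nat) : \bar R :=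
  (\sum_(t <oo) ((t - l)%:R * p_tau m l t)%:E
   + +oo * (1 - \sum_(t <oo) (p_tau m l t)%:E))%E.

Definition error_prob (A : nat) : \bar R :=
  (((A * M)%:R^-1)%:E * \sum_(m < M) \sum_(1 <= l < A.+1) p_err m l)%E.

Definition avg_delay (A : nat) : \bar R :=
  (((A * M)%:R^-1)%:E * \sum_(m < M) \sum_(1 <= l < A.+1) exp_delay m l)%E.

(* rate ln M / E(tau-nu)^+ is at least r (division-free form: r * E <= ln M,
   which handles E = 0 (rate +oo) and E = +oo (rate 0)) *)
Definition rate_at_least (A : nat) (r : R) : Prop :=
  (r%:E * avg_delay A <= (ln M%:R)%:E)%E.

End Perf.

Definition async_level (a eps : R) (N A : nat) : Prop :=
  A%:R - 1 < expR ((a - eps) * N%:R) <= A%:R.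

Definition good_code (r a eps : R) (N M : nat) (C : code X Y N M) : Prop :=
  (2 <= M)%N /\ forall A, async_level a eps N A ->
    rate_at_least C A (r - eps) /\ (error_prob C A <= eps%:E)%E.

Definition achievable (r a : R) : Prop :=
  forall eps, 0 < eps -> exists N0 : nat, forall N, (N0 <= N)%N ->
    exists M (C : code X Y N M), good_code r a eps C.

Definition alpha_rate (r : R) : \bar R :=
  ereal_sup [set a%:E | a in [set a | achievable r a]].

Definition sync_threshold : \bar R := alpha_rate 0.

End Async.

(* Main.v *)
Require Import Defs.
From HB Require Import structures.
From mathcomp Require Import all_boot all_order all_algebra.
From mathcomp Require Import all_classical all_reals all_analysis.
From mathcomp Require Import zify ring lra.
Import Order.TTheory GRing.Theory Num.Theory.
Import numFieldNormedType.Exports.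
Local Open Scope classical_set_scope.
Local Open Scope ring_scope.

(** Only the error probability matters at rate zero, so the decoder may wait
   until the whole window has been observed.

   Achievability.  A codeword is a long run of the maximizing letter followed by
   a short random word.  The decoder looks for a message and a window whose
   divergence score [sync_score] and information score [info_score] both exceed
   their thresholds.  A window of pure noise passes the first test with
   probability exponentially small at a rate exceeding the asynchronism
   exponent; a window overlapping the transmitted word is handled by the second
   test alone, because an independent random word fails it whatever the output.
   All tails are bounded by exponential moments.

   Converse.  When the asynchronism exponent exceeds all the divergences, the
   likelihood ratio between "message m at a uniform time" and pure noise,
   truncated to typical windows, has second moment close to one, so that it is
   close to one in mean.  The probabilities of correctly decoding the messages
   then sum to little more than one. *)

Set Implicit Arguments. Unset Strict Implicit. Unset Printing Implicit Defensive.

(** * Product measures on tuples *)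

Section TupleSums.
Variables (R : realType) (Y : finType) (y0 : Y).

Lemma sum_tuple_rcons n (F : seq Y -> R) :
  \sum_(y : n.+1.-tuple Y) F y = \sum_(z : n.-tuple Y) \sum_(b : Y) F (rcons z b).
Proof.
rewrite pair_big /=.
pose h (p : n.-tuple Y * Y) : n.+1.-tuple Y := [tuple of rcons p.1 p.2].
have hi : injective h.
  move=> [z b] [z' b'] /(congr1 val) /= /eqP; rewrite eqseq_rcons => /andP[/eqP e /eqP ->].
  by congr (_, _); apply: val_inj.
have hb : bijective h.
  by apply: (inj_card_bij hi); rewrite card_prod !card_tuple expnSr.
by rewrite (reindex h) //=; apply: onW_bij.
Qed.

Lemma sum_tuple0 (F : seq Y -> R) : \sum_(y : 0.-tuple Y) F y = F [::].
Proof. by rewrite (big_pred1 [tuple]) // => y; apply/esym/eqP; apply: val_inj; case: y => -[]. Qed.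

(** Splitting off the last coordinate gives an induction: the expectation of a product of functions
    of independent coordinates factors. *)
Lemma sum_tuple_prod n (f : nat -> Y -> R) :
  \sum_(y : n.-tuple Y) \prod_(i < n) f i (nth y0 y i) = \prod_(i < n) \sum_b f i b.
Proof.
elim: n => [|n IH].
  by rewrite (sum_tuple0 (fun y => \prod_(i < 0) f i (nth y0 y i))) !big_ord0.
rewrite (sum_tuple_rcons _ (fun y => \prod_(i < n.+1) f i (nth y0 y i))).
rewrite big_ord_recr /= -IH mulr_suml; apply: eq_bigr => z _.
rewrite mulr_sumr; apply: eq_bigr => b _; rewrite big_ord_recr /=; congr (_ * _).
  by apply: eq_bigr => i _; rewrite nth_rcons size_tuple ltn_ord.
by rewrite nth_rcons size_tuple ltnn eqxx.
Qed.

(** Padding with factors 1 lets a statistic of a window be merged, coordinate by coordinate, with a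
    product measure on the whole time range. *)
Lemma prod_window (f : nat -> R) o n T : (o + n <= T)%N ->
  \prod_(j < T) (if (o <= j < o + n)%N then f (j - o)%N else 1) = \prod_(i < n) f i.
Proof.
move=> le.
rewrite -(big_mkord xpredT (fun j => if (o <= j < o + n)%N then f (j - o)%N else 1)).
rewrite (big_cat_nat (n := o + n)) //=.
rewrite (big_cat_nat (n := o)) ?leq_addr //=.
rewrite big_nat_cond big1 ?mul1r; last by move=> i Hi; case: ifP => //; lia.
rewrite [X in _ * X]big_nat_cond [X in _ * X]big1 ?mulr1; last by move=> i Hi; case: ifP => //; lia.
rewrite -{1}(add0n o) big_addn addKn big_mkord.
by apply: eq_bigr => i _; rewrite addnK ifT //; case: i => i /= Hi; lia.
Qed.

Variable q : nat -> Y -> R.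
Hypothesis q0 : forall i b, 0 <= q i b.
Hypothesis q1 : forall i, \sum_b q i b = 1.

(** The argument is a list rather than a tuple, so that prefixes can be evaluated without casts;
    [y0] only serves as the default of [nth]. *)
Definition pmass n (y : seq Y) : R := \prod_(i < n) q i (nth y0 y i).

Lemma pmass_ge0 n y : 0 <= pmass n y.
Proof. exact: prodr_ge0. Qed.

Lemma sum_pmass n : \sum_(y : n.-tuple Y) pmass n y = 1.
Proof. by rewrite /pmass sum_tuple_prod big1. Qed.

Lemma sum_pmass_window (phi : nat -> Y -> R) o n T : (o + n <= T)%N ->
  \sum_(y : T.-tuple Y) pmass T y * \prod_(i < n) phi i (nth y0 y (o + i)) =
  \prod_(i < n) \sum_b q (o + i) b * phi i b.
Proof.
move=> le; rewrite -(prod_window (fun i => \sum_b q (o + i) b * phi i b) le).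
pose f j b := if (o <= j < o + n)%N then q j b * phi (j - o)%N b else q j b.
transitivity (\sum_(y : T.-tuple Y) \prod_(j < T) f j (nth y0 y j)).
  apply: eq_bigr => y _.
  rewrite -(prod_window (fun i => phi i (nth y0 y (o + i))) le) -big_split /=.
  by apply: eq_bigr => j _; rewrite /f; case: ifP => H; rewrite ?mulr1 // subnKC //; lia.
rewrite sum_tuple_prod; apply: eq_bigr => j _.
by rewrite /f; case: ifP => H; [rewrite subnKC //; lia | exact: q1].
Qed.

(** Disjoint windows are independent under a product measure. The converse needs this for the cross
    terms of a second moment. *)
Lemma sum_pmass_two_windows (phi psi : nat -> Y -> R) o o' n T :
  (o + n <= T)%N -> (o' + n <= T)%N -> (o + n <= o')%N || (o' + n <= o)%N ->
  (forall i, (i < n)%N -> \sum_b q (o + i) b * phi i b = 1) ->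
  (forall i, (i < n)%N -> \sum_b q (o' + i) b * psi i b = 1) ->
  \sum_(y : T.-tuple Y) pmass T y * (\prod_(i < n) phi i (nth y0 y (o + i)) *
    \prod_(i < n) psi i (nth y0 y (o' + i))) = 1.
Proof.
move=> le le' dis phi1 psi1.
pose f j b := if (o <= j < o + n)%N then q j b * phi (j - o)%N b
  else if (o' <= j < o' + n)%N then q j b * psi (j - o')%N b else q j b.
transitivity (\sum_(y : T.-tuple Y) \prod_(j < T) f j (nth y0 y j)).
  apply: eq_bigr => y _.
  rewrite -(prod_window (fun i => phi i (nth y0 y (o + i))) le).
  rewrite -(prod_window (fun i => psi i (nth y0 y (o' + i))) le') -!big_split /=.
  apply: eq_bigr => j _; rewrite /f; case: ifP => H.
    by rewrite ifF ?mulr1 ?subnKC //; lia.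
  by case: ifP => H'; rewrite mul1r ?mulr1 // subnKC //; lia.
rewrite sum_tuple_prod big1 // => j _; rewrite /f.
case: (boolP (o <= j < o + n)%N) => H.
  by rewrite -[RHS](phi1 (j - o)%N) ?subnKC //; lia.
case: (boolP (o' <= j < o' + n)%N) => H'; last exact: q1.
by rewrite -[RHS](psi1 (j - o')%N) ?subnKC //; lia.
Qed.

(** Consistency of the marginals: the later coordinates sum to one. Events at different stopping
    times can thus be moved to one common horizon. *)
Lemma sum_pmass_take (F : seq Y -> R) t T : (t <= T)%N ->
  \sum_(y : T.-tuple Y) pmass T y * F (take t y) = \sum_(y : t.-tuple Y) pmass t y * F y.
Proof.
elim: T => [|T IH].
  rewrite leqn0 => /eqP ->; apply: eq_bigr => y _.
  by rewrite take_oversize ?size_tuple.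
rewrite leq_eqVlt => /orP[/eqP ->|lt].
  by apply: eq_bigr => y _; rewrite take_oversize ?size_tuple.
rewrite -IH // (sum_tuple_rcons _ (fun y => pmass T.+1 y * F (take t y))).
apply: eq_bigr => z _.
under eq_bigr => b _.
  rewrite -cats1 takel_cat ?size_tuple // cats1 /pmass big_ord_recr /=.
  rewrite nth_rcons size_tuple ltnn eqxx.
  under eq_bigr => i _ do rewrite nth_rcons size_tuple ltn_ord.
  rewrite mulrAC.
  over.
by rewrite -mulr_sumr q1 mulr1.
Qed.

End TupleSums.

(** The offsets [j] of the windows meeting the one at [o] all lie in an interval of length [2 * N];
    the truncation in [o.+1 - N] does no harm. *)
Lemma sum_near (R : realType) (A N o : nat) :
  \sum_(j < A | (o < j + N)%N && (j < o + N)%N) 1 <= (2 * N)%:R :> R.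
Proof.
rewrite sumr_const ler_nat cardE size_filter -enumT -(count_map val
  (fun j => (o < j + N)%N && (j < o + N)%N)) val_enum_ord -size_filter.
rewrite -(size_iota (o.+1 - N) (2 * N)); apply: uniq_leq_size.
  by rewrite filter_uniq // iota_uniq.
by move=> j; rewrite mem_filter !mem_iota; lia.
Qed.

(** * Exponential moments and random codebooks *)

(** Follows from [expR x <= (1 - x)^-1], since [(1 + x + 2 * x ^+ 2) * (1 - x)] exceeds 1 by
    [x ^+ 2 * (1 - 2 * x)]. *)
Lemma expR_le_quadratic (R : realType) (x : R) : x <= 1 / 2 -> expR x <= 1 + x + 2 * x ^+ 2.
Proof.
move=> hx; have h1 : 0 < 1 - x by lra.
have h2 : 1 - x <= expR (- x) by exact: expR_ge1Dx.
have h3 : expR x <= (1 - x)^-1.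
  by rewrite -[expR x]invrK -expRN lef_pV2 // posrE ?expR_gt0.
apply: le_trans h3 _; rewrite -div1r ler_pdivrMr //.
rewrite -subr_ge0 (_ : _ - 1 = x ^+ 2 * (1 - 2 * x)); last by ring.
by rewrite mulr_ge0 ?sqr_ge0 //; lra.
Qed.

(** Chernoff estimate: a positive mean makes the Laplace transform decrease at first order near 0.
    The constants are uniform in [i], so that they serve for all letters of a codeword at once. *)
Lemma exp_moment_lt1 (R : realType) (I Z : finType) (p G : I -> Z -> R) (d : R) :
  0 < d -> (forall i z, 0 <= p i z) -> (forall i, \sum_z p i z = 1) ->
  (forall i, d <= \sum_z p i z * G i z) ->
  exists lam kap : R, [/\ 0 < lam, 0 < kap &
    forall i, \sum_z p i z * expR (- lam * G i z) <= expR (- kap)].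
Proof.
move=> d0 p0 p1 dG.
pose B := 1 + d + \sum_i \sum_z `|G i z|.
have S0 : 0 <= \sum_i \sum_z `|G i z| by do 2 (apply: sumr_ge0 => ? _).
have B1 : 1 + d <= B by rewrite /B lerDl.
have GB i z : `|G i z| <= B.
  rewrite /B (bigD1 i) //= (bigD1 z) //=.
  have h1 : 0 <= \sum_(j | j != i) \sum_z `|G j z| by do 2 (apply: sumr_ge0 => ? _).
  have h2 : 0 <= \sum_(j | j != z) `|G i j| by apply: sumr_ge0 => ? _.
  lra.
(* With this choice the quadratic error [2 * lam ^+ 2 * B ^+ 2] is [lam * d / 2], half of the linear
   gain [lam * d]. *)
pose lam := d / (4 * B ^+ 2).
have B0 : 0 < B by lra.
have lam0 : 0 < lam by rewrite divr_gt0 // mulr_gt0 // exprn_gt0.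
have lamB : lam * B ^+ 2 = d / 4.
  rewrite /lam; field; lra.
have lamB' : lam * B <= 1 / 2.
  have : lam * B * B <= 1 / 2 * B by rewrite -mulrA -expr2 lamB; lra.
  by rewrite ler_pM2r.
exists lam, (lam * d / 2); split => //; first by rewrite divr_gt0 // mulr_gt0.
move=> i.
have pt z : expR (- lam * G i z) <= 1 - lam * G i z + lam * d / 2.
  have hG := GB i z.
  have h1 : - lam * G i z <= 1 / 2.
    apply: le_trans lamB'; rewrite mulNr -mulrN ler_pM2l //.
    by apply: le_trans hG; rewrite -normrN ler_norm.
  apply: le_trans (expR_le_quadratic h1) _; rewrite mulNr lerD2l.
  rewrite sqrrN exprMn.
  have h2 : G i z ^+ 2 <= B ^+ 2 by rewrite -[G i z ^+ 2]ger0_norm ?sqr_ge0 // normrX lerXn2r ?nnegrE // ltW.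
  have h3 : 2 * (lam ^+ 2 * G i z ^+ 2) <= 2 * (lam ^+ 2 * B ^+ 2).
    by rewrite ler_pM2l // ler_pM2l // exprn_gt0.
  apply: le_trans h3 _.
  by rewrite expr2 -mulrA lamB; lra.
have h4 : \sum_z p i z * expR (- lam * G i z) <= 1 - lam * d / 2.
  apply: (@le_trans _ _ (\sum_z p i z * (1 - lam * G i z + lam * d / 2))).
    by apply: ler_sum => z _; apply: ler_wpM2l.
  have E z : p i z * (1 - lam * G i z + lam * d / 2) =
    (1 + lam * d / 2) * p i z - lam * (p i z * G i z) by ring.
  rewrite (eq_bigr _ (fun z _ => E z)) sumrB -!mulr_sumr p1.
  have := dG i; rewrite -(ler_pM2l lam0) => h; lra.
apply: le_trans h4 _.
by have := @expR_ge1Dx R (- (lam * d / 2)).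
Qed.

(* A dual form of the divergence, as in the Donsker-Varadhan formula: the
   log-likelihood ratio is perturbed so as to be finite everywhere. *)
Lemma KL_dual (R : realType) (Y : finType) (p q : Y -> R) (a : R) :
  (forall y, 0 <= p y) -> \sum_y p y = 1 -> (forall y, 0 <= q y) -> \sum_y q y = 1 ->
  (a%:E < KL p q)%E ->
  exists g : Y -> R, \sum_y q y * expR (g y) <= 1 /\ a < \sum_y p y * g y.
Proof.
move=> p0 p1 q0 q1 aK.
have [ac|] := pselect (forall y, q y = 0 -> p y = 0); last first.
  move=> /existsNP[y1 /not_implyP[qy1 /eqP py1]].
  have py1' : 0 < p y1 by rewrite lt_neqAle eq_sym py1 p0.
  (* A reward placed on an output that [q] never produces costs nothing under [q] and contributes
     [|a| + 1] under [p]. *)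
  pose K := (`|a| + 1) / p y1.
  have K0 : 0 < K by rewrite divr_gt0 // ltr_wpDl.
  exists (fun y => if q y == 0 then K else 0); split.
    rewrite -[X in _ <= X]q1; apply: ler_sum => y _.
    by case: eqVneq => [->|_]; rewrite ?mul0r // expR0 mulr1.
  rewrite (bigD1 y1) //= qy1 eqxx.
  have h : 0 <= \sum_(i | i != y1) p i * (if q i == 0 then K else 0).
    by apply: sumr_ge0 => i _; apply: mulr_ge0 => //; case: ifP => // _; apply: ltW.
  have -> : p y1 * K = `|a| + 1 by rewrite /K mulrCA divff // mulr1.
  have := ler_norm a; lra.
pose k y := if p y == 0 then 0 else p y * ln (p y / q y).
have KE : KL p q = (\sum_y k y)%:E.
  rewrite /KL -sumEFin; apply: eq_bigr => y _; rewrite /k.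
  case: (eqVneq (p y) 0) => // py; case: eqVneq => // qy.
  by rewrite (ac _ qy) eqxx in py.
rewrite KE lte_fin in aK.
(* Half of the gap is given up: the exponential moment becomes at most
   [(1 + eta) * expR (- eta) <= 1], and the mean stays above [a]. *)
pose eta := (\sum_y k y - a) / 2.
have eta0 : 0 < eta by rewrite /eta; lra.
exists (fun y => (if p y == 0 then ln eta else ln (p y / q y)) - eta); split.
  apply: (@le_trans _ _ (\sum_y (q y * eta + p y) * expR (- eta))).
    apply: ler_sum => y _; rewrite expRD mulrA ler_pM2r ?expR_gt0 //.
    case: eqVneq => [->|py]; first by rewrite lnK ?posrE // addr0.
    have qy : q y != 0 by apply/eqP => /ac /eqP; rewrite (negPf py).
    have py' : 0 < p y by rewrite lt_neqAle eq_sym py p0.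
    have qy' : 0 < q y by rewrite lt_neqAle eq_sym qy q0.
    rewrite lnK ?posrE ?divr_gt0 // mulrCA divff // mulr1 lerDr.
    by rewrite mulr_ge0 // ltW.
  rewrite -mulr_suml big_split /= -mulr_suml p1 q1 mul1r.
  by rewrite expRN ler_pdivrMr ?expR_gt0 // mul1r addrC expR_ge1Dx.
have E y : p y * ((if p y == 0 then ln eta else ln (p y / q y)) - eta) = k y - eta * p y.
  rewrite /k; case: eqVneq => [->|_]; first by rewrite mul0r mulr0 subr0.
  by ring.
rewrite (eq_bigr _ (fun y _ => E y)) sumrB -mulr_sumr p1 mulr1 /eta; lra.
Qed.

(** Same perturbation as in [KL_dual], applied to the information density of an input law with
    positive mutual information. The exponential moment is controlled for each fixed output, not
    only on average, so that false words can be handled without knowing the output law. *)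
Lemma information_density_dual (R : realType) (X Y : finType) (Q : X -> Y -> R) :
  is_channel Q -> 0 < capacity Q ->
  exists (P : X -> R) (h : X -> Y -> R),
    [/\ (forall x, 0 <= P x), \sum_x P x = 1,
        forall y, \sum_x P x * expR (h x y) <= 1 &
        0 < \sum_x \sum_y P x * Q x y * h x y].
Proof.
move=> [Q0 Q1] C0.
have [P [P0 P1] I0] : exists2 P, input_dists P & 0 < mutual_info Q P.
  apply: contrapT => /forall2NP H.
  suff : capacity Q <= 0 by rewrite leNgt C0.
  rewrite /capacity.
  have [[x ix]|ne] := pselect ([set mutual_info Q P | P in @input_dists R X] !=set0).
    apply: ge_sup; first by exists x.
    by move=> _ [P iP <-]; case: (H P) => // /negP; rewrite -leNgt.
  (* The supremum of the empty set is 0 by convention. *)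
  by move/set0P/negP: ne; rewrite negbK => /eqP ->; rewrite sup0.
exists P.
pose eta := mutual_info Q P / 2.
have eta0 : 0 < eta by rewrite /eta; lra.
have o0 y : 0 <= out_dist Q P y by apply: sumr_ge0 => x _; apply: mulr_ge0.
exists (fun x y => (if P x * Q x y == 0 then ln eta else ln (Q x y / out_dist Q P y)) - eta).
split => //.
  move=> y.
  apply: (@le_trans _ _ (\sum_x (P x * eta + P x * Q x y / out_dist Q P y) * expR (- eta))).
    apply: ler_sum => x _; rewrite expRD mulrA ler_pM2r ?expR_gt0 //.
    case: eqVneq => [->|PQ]; first by rewrite lnK ?posrE // mul0r addr0.
    have PQ' : 0 < P x * Q x y by rewrite lt_neqAle eq_sym PQ mulr_ge0.
    have Q' : 0 < Q x y.
      by rewrite lt_neqAle Q0 andbT eq_sym; apply: contraNneq PQ => ->; rewrite mulr0.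
    have o' : 0 < out_dist Q P y.
      apply: lt_le_trans PQ' _; rewrite /out_dist (bigD1 x) //= lerDl.
      by apply: sumr_ge0 => z _; apply: mulr_ge0.
    by rewrite lnK ?posrE ?divr_gt0 // mulrA lerDr mulr_ge0 // ltW.
  rewrite -mulr_suml big_split /= -!mulr_suml P1 mul1r -/(out_dist Q P y).
  rewrite expRN ler_pdivrMr ?expR_gt0 // mul1r.
  apply: le_trans (expR_ge1Dx eta); rewrite addrC lerD2r.
  by have [->|n0] := eqVneq (out_dist Q P y) 0; rewrite ?mul0r ?ler01 // divff.
suff -> : \sum_x \sum_y P x * Q x y *
   ((if P x * Q x y == 0 then ln eta else ln (Q x y / out_dist Q P y)) - eta) =
   mutual_info Q P - eta by rewrite /eta; lra.
rewrite /mutual_info.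
have e : \sum_x \sum_y eta * (P x * Q x y) = eta.
  under eq_bigr => x _ do rewrite -mulr_sumr -mulr_sumr Q1 mulr1.
  by rewrite -mulr_sumr P1 mulr1.
rewrite -[X in _ = _ - X]e -sumrB; apply: eq_bigr => x _; rewrite -sumrB; apply: eq_bigr => y _.
case: eqVneq => [->|_]; first by rewrite mul0r mulr0 subr0.
by ring.
Qed.

(** * Averages over codebooks with independent words *)

Section Codebook.
Variables (R : realType) (V : finType) (p : V -> R) (M : nat).
Hypothesis p1 : \sum_v p v = 1.

Definition book_weight (f : {ffun 'I_M -> V}) : R := \prod_m p (f m).

Lemma sum_book_weight : \sum_f book_weight f = 1.
Proof. by rewrite /book_weight -(bigA_distr_bigA (fun _ => p)) big1. Qed.

Lemma sum_book1 (m : 'I_M) (G : V -> R) :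
  \sum_f book_weight f * G (f m) = \sum_u p u * G u.
Proof.
transitivity (\sum_(f : {ffun 'I_M -> V}) \prod_j (p (f j) * (if j == m then G (f j) else 1))).
  apply: eq_bigr => f _; rewrite big_split /=; congr (_ * _).
  by rewrite (bigD1 m) //= eqxx big1 ?mulr1 // => j /negPf ->.
rewrite -(bigA_distr_bigA (fun j v => p v * (if j == m then G v else 1))).
rewrite (bigD1 m) //= eqxx [X in _ * X]big1 ?mulr1 // => j /negPf ->.
by under eq_bigr do rewrite mulr1.
Qed.

(** Two distinct words of a random codebook are independent. *)
Lemma sum_book2 (m m' : 'I_M) (G : V -> V -> R) : m' != m ->
  \sum_f book_weight f * G (f m) (f m') = \sum_u p u * \sum_v p v * G u v.
Proof.
move=> ne.
(* Summing over the value [u] of [f m] turns the coupled factor [G (f m) (f m')] into a product over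
   messages. *)
transitivity (\sum_u \sum_(f : {ffun 'I_M -> V}) \prod_j (p (f j) * (if j == m then (f j == u)%:R
    else if j == m' then G u (f j) else 1))).
  rewrite exchange_big; apply: eq_bigr => f _; rewrite (bigD1 (f m)) //=.
  rewrite [X in _ + X]big1 ?addr0; last first.
    move=> u nu; rewrite (bigD1 m) //= eqxx (_ : (f m == u) = false) ?mulr0 ?mul0r //.
    by apply/negbTE; rewrite eq_sym.
  rewrite big_split /=; congr (_ * _).
  rewrite (bigD1 m) //= !eqxx mul1r (bigD1 m') //= (negPf ne) eqxx big1 ?mulr1 //.
  by move=> j /andP[/negPf -> /negPf ->].
apply: eq_bigr => u _.
rewrite -(bigA_distr_bigA (fun j v => p v * (if j == m then (v == u)%:R
    else if j == m' then G u v else 1))).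
rewrite (bigD1 m) //= eqxx (bigD1 m') //= (negPf ne) eqxx [X in _ * (_ * X)]big1 ?mulr1.
  congr (_ * _); rewrite (bigD1 u) //= eqxx mulr1 big1 ?addr0 // => v /negPf ->.
  by rewrite mulr0.
move=> j /andP[/negPf -> /negPf ->].
by under eq_bigr do rewrite mulr1.
Qed.

End Codebook.

(** The probabilistic method: if every [E f] exceeded [b], all the weights would have to vanish. *)
Lemma weighted_mean_exists (R : realType) (F : finType) (w E : F -> R) (b : R) :
  (forall f, 0 <= w f) -> \sum_f w f = 1 -> \sum_f w f * E f <= b ->
  exists f, E f <= b.
Proof.
move=> w0 w1 h; apply: contrapT => /forallNP H.
have H' f : 0 < E f - b by rewrite subr_gt0 ltNge; apply/negP/H.
have s0 f : true -> 0 <= w f * (E f - b) by move=> _; rewrite mulr_ge0 // ltW.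
have z : \sum_f w f * (E f - b) = 0.
  apply/eqP; rewrite eq_le sumr_ge0 // andbT.
  under eq_bigr do rewrite mulrBr.
  by rewrite sumrB -mulr_suml w1 mul1r subr_le0.
have wz f : w f = 0.
  move/eqP: z; rewrite psumr_eq0 // => /allP /(_ f (mem_index_enum f)) /eqP /eqP.
  by rewrite mulf_eq0 [_ - _ == 0]gt_eqF // orbF => /eqP.
by move: w1; rewrite big1 // => /esym/eqP; rewrite oner_eq0.
Qed.

(** * Stopping times *)

Lemma sum_indicator_le1 (R : realType) (I : finType) (b : pred I) :
  (forall i j, b i -> b j -> i = j) -> \sum_i (b i)%:R <= 1 :> R.
Proof.
move=> H; have [i bi|nb] := pickP b; last by rewrite big1 // => i _; rewrite nb.
rewrite (bigD1 i) //= bi big1 ?addr0 // => j ji.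
by case bj : (b j) => //; move: ji; rewrite (H j i) // eqxx.
Qed.

Lemma nneseries_le (R : realType) (u : nat -> R) (b : R) :
  (forall n, 0 <= u n) -> (forall T, \sum_(t < T) u t <= b) ->
  (\sum_(t <oo) (u t)%:E <= b%:E)%E.
Proof.
move=> u0 H; apply: lime_le.
  by apply: is_cvg_nneseries => n _ _; rewrite lee_fin.
by apply: nearW => T; rewrite sumEFin lee_fin big_mkord.
Qed.

Section Stopping.
Variables (R : realType) (X Y : finType) (Q : X -> Y -> R) (star : X) (y0 : Y).
Hypothesis Qch : is_channel Q.
Variables (N M : nat) (C : Defs.code X Y N M).

Let Q0 := Qch.1.
Let Q1 := Qch.2.

(** Coordinates are numbered from 0 and channel times from 1, hence [i.+1]. *)
Definition law (m : 'I_M) (l i : nat) (b : Y) : R := Q (inp star (cw C m) l i.+1) b.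

Lemma law_ge0 m l i b : 0 <= law m l i b. Proof. exact: Q0. Qed.
Lemma sum_law m l i : \sum_b law m l i b = 1. Proof. exact: Q1. Qed.

Lemma pref_probE m l t (y : t.-tuple Y) :
  pref_prob Q star C m l y = pmass y0 (law m l) t y.
Proof. by apply: eq_bigr => i _; rewrite (tnth_nth y0). Qed.

(** A version of [stops_at] on lists, which can be evaluated on all prefixes of one output
    sequence. *)
Definition first_stop (y : seq Y) : bool :=
  [&& (0 < size y)%N, stop C y &
      [forall s : 'I_(size y), (0 < s)%N ==> ~~ stop C (take s y)]].

Lemma stops_atE t (y : t.-tuple Y) : stops_at C y = first_stop y.
Proof. by case: y => s sz; have e := eqP sz; subst t. Qed.

Lemma p_tauE m l t :
  p_tau Q star C m l t = \sum_(y : t.-tuple Y) pmass y0 (law m l) t y * (first_stop y)%:R.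
Proof.
rewrite /p_tau big_mkcond; apply: eq_bigr => y _; rewrite stops_atE pref_probE.
by case: first_stop; rewrite ?mulr1 ?mulr0.
Qed.

Lemma p_correctE m l t : p_correct Q star C m l t =
  \sum_(y : t.-tuple Y) pmass y0 (law m l) t y * (first_stop y && (dec C y == m))%:R.
Proof.
rewrite /p_correct big_mkcond; apply: eq_bigr => y _; rewrite stops_atE pref_probE.
by case: (_ && _); rewrite ?mulr1 ?mulr0.
Qed.

(** Of two distinct prefixes the shorter is a proper prefix of the longer, where stopping earlier is
    forbidden. *)
Lemma first_stop_inj (y : seq Y) s t : (s <= size y)%N -> (t <= size y)%N ->
  first_stop (take s y) -> first_stop (take t y) -> s = t.
Proof.
have H u v : (v <= size y)%N ->
    first_stop (take u y) -> first_stop (take v y) -> ~~ (u < v)%N.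
  move=> vy /and3P[]; rewrite size_take => u0 su _ /and3P[] _ _ /forallP H.
  apply/negP => uv.
  have uv' : (u < size (take v y))%N by rewrite size_takel.
  move: (H (Ordinal uv')) => /=; rewrite take_takel ?(ltnW uv) // su.
  by move: u0; rewrite (leq_trans uv vy) => ->.
move=> sy ty fs ft; apply/eqP; rewrite eqn_leq leqNgt (H t s) //=.
by rewrite leqNgt (H s t).
Qed.

Lemma sum_first_stop (T : nat) (y : T.-tuple Y) :
  \sum_(t < T) (first_stop (take t y))%:R <= 1 :> R.
Proof.
apply: sum_indicator_le1 => s t fs ft; apply: val_inj => /=.
by apply: first_stop_inj fs ft; rewrite size_tuple ltnW.
Qed.

(** All stopping events up to [T] are realized on the same space of sequences of length [T], where
    their disjointness can be used pointwise. *)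
Lemma partial_sum_tau m l T : \sum_(t < T) p_tau Q star C m l t =
  \sum_(y : T.-tuple Y) pmass y0 (law m l) T y * \sum_(t < T) (first_stop (take t y))%:R.
Proof.
under [RHS]eq_bigr do rewrite mulr_sumr.
rewrite exchange_big /=; apply: eq_bigr => t _; rewrite p_tauE.
by rewrite (@sum_pmass_take _ _ _ _ (sum_law m l) (fun y => (first_stop y)%:R)) // ltnW.
Qed.

Lemma partial_sum_correct m l T : \sum_(t < T) p_correct Q star C m l t =
  \sum_(y : T.-tuple Y) pmass y0 (law m l) T y *
    \sum_(t < T) (first_stop (take t y) && (dec C (take t y) == m))%:R.
Proof.
under [RHS]eq_bigr do rewrite mulr_sumr.
rewrite exchange_big /=; apply: eq_bigr => t _; rewrite p_correctE.
by rewrite (@sum_pmass_take _ _ _ _ (sum_law m l)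
  (fun y => (first_stop y && (dec C y == m))%:R)) // ltnW.
Qed.

Lemma p_tau_ge0 m l t : 0 <= p_tau Q star C m l t.
Proof. by rewrite p_tauE; apply: sumr_ge0 => y _; rewrite mulr_ge0 //; apply: pmass_ge0 => *; apply: law_ge0. Qed.

Lemma p_correct_ge0 m l t : 0 <= p_correct Q star C m l t.
Proof. by rewrite p_correctE; apply: sumr_ge0 => y _; rewrite mulr_ge0 //; apply: pmass_ge0 => *; apply: law_ge0. Qed.

Lemma p_correct_le_tau m l t : p_correct Q star C m l t <= p_tau Q star C m l t.
Proof.
rewrite p_correctE p_tauE; apply: ler_sum => y _; apply: ler_wpM2l.
  by apply: pmass_ge0 => *; apply: law_ge0.
by case: first_stop; case: (_ == _).
Qed.

Lemma partial_sum_tau_le1 m l T : \sum_(t < T) p_tau Q star C m l t <= 1.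
Proof.
rewrite partial_sum_tau -[X in _ <= X](sum_pmass y0 (sum_law m l) T); apply: ler_sum => y _.
apply: ler_piMr; last exact: sum_first_stop.
by apply: pmass_ge0 => *; apply: law_ge0.
Qed.

Lemma series_tau_le1 m l : (\sum_(t <oo) (p_tau Q star C m l t)%:E <= 1)%E.
Proof. by apply: nneseries_le => [n|T]; [exact: p_tau_ge0 | exact: partial_sum_tau_le1]. Qed.

Lemma series_correct_le1 m l : (\sum_(t <oo) (p_correct Q star C m l t)%:E <= 1)%E.
Proof.
apply: nneseries_le => [n|T]; first exact: p_correct_ge0.
by apply: le_trans (partial_sum_tau_le1 m l T); apply: ler_sum => t _; apply: p_correct_le_tau.
Qed.

Lemma exp_delay_ge0 m l : (0 <= exp_delay Q star C m l)%E.
Proof.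
apply: adde_ge0.
  by apply: nneseries_ge0 => n _ _; rewrite lee_fin mulr_ge0 // p_tau_ge0.
apply: mule_ge0; first exact: leey.
by rewrite sube_ge0 ?orbT //; apply: series_tau_le1.
Qed.

(** The delay is nonnegative, possibly infinite, so a nonpositive rate imposes no constraint. This
    is why only the error probability matters at rate zero. *)
Lemma rate_at_least_nonpos A (r : R) : r <= 0 -> (0 < M)%N -> rate_at_least Q star C A r.
Proof.
move=> r0 M0; apply: (@le_trans _ _ 0%E); last by rewrite lee_fin ln_ge0 // ler1n.
apply: mule_le0_ge0; first by rewrite lee_fin.
apply: mule_ge0; first by rewrite lee_fin invr_ge0.
by do 2 (apply: sume_ge0 => ? _); apply: exp_delay_ge0.
Qed.

End Stopping.

(** * Converse *)

Section Noise.
Variables (R : realType) (X Y : finType) (Q : X -> Y -> R) (star : X) (y0 : Y).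
Hypothesis Qch : is_channel Q.
Hypothesis ac : forall x b, Q star b = 0 -> Q x b = 0.
Variables (theta lam kap : R).
Hypothesis lam0 : 0 < lam.

Let Q0 := Qch.1.
Let Q1 := Qch.2.

Definition lr x b : R := Q x b / Q star b.

Hypothesis tail : forall x, \sum_b Q x b * expR (- lam * (theta - ln (lr x b))) <= expR (- kap).

Lemma lr_ge0 x b : 0 <= lr x b.
Proof. by rewrite divr_ge0 ?Q0. Qed.

(** Absolute continuity makes the convention that division by 0 gives 0 harmless in [lr]. *)
Lemma mul_lr x b : Q star b * lr x b = Q x b.
Proof.
rewrite /lr; have [e|n] := eqVneq (Q star b) 0; first by rewrite e mul0r ac.
by rewrite mulrCA divff // mulr1.
Qed.

Lemma sum_lr x : \sum_b Q star b * lr x b = 1.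
Proof. by under eq_bigr do rewrite mul_lr. Qed.

Let noise T (y : seq Y) := pmass y0 (fun _ => Q star) T y.

Let noise_ge0 T y : 0 <= noise T y.
Proof. exact: pmass_ge0. Qed.

Variables (N A T : nat) (w : nat -> X).
Hypothesis A0 : (0 < A)%N.
Hypothesis AT : (A + N <= T)%N.

(** Density, relative to pure noise, of the output law when [w] is sent at offset [o], that is, from
    time [o.+1] on. *)
Definition lik (o : nat) (y : seq Y) : R := \prod_(i < N) lr (w i) (nth y0 y (o + i)).

(* Junk value: [ln 0 = 0], so [llik] is the logarithm of [lik] only where [lik] is positive. *)
Definition llik (o : nat) (y : seq Y) : R := \sum_(i < N) ln (lr (w i) (nth y0 y (o + i))).

(** Truncating to this event caps the likelihood ratio at [expR (N%:R * theta)], without which its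
    second moment could be too large. *)
Definition typ (o : nat) (y : seq Y) : bool := llik o y <= N%:R * theta.

Definition tlik (o : nat) (y : seq Y) : R := lik o y * (typ o y)%:R.

Lemma lik_ge0 o y : 0 <= lik o y.
Proof. by apply: prodr_ge0 => i _; apply: lr_ge0. Qed.

Lemma tlik_ge0 o y : 0 <= tlik o y.
Proof. by rewrite mulr_ge0 ?lik_ge0. Qed.

Lemma tlik_le_lik o y : tlik o y <= lik o y.
Proof. by rewrite ler_piMr ?lik_ge0 // lern1; case: typ. Qed.

(** Only an inequality: a zero factor corresponds to [expR (ln 0) = 1] on the right. *)
Lemma lik_le_exp o y : lik o y <= expR (llik o y).
Proof.
rewrite expR_sum; apply: ler_prod => i _; rewrite lr_ge0 /=.
have := lr_ge0 (w i) (nth y0 y (o + i)); rewrite le_eqVlt => /orP[/eqP <-|h].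
  exact: expR_ge0.
by rewrite lnK.
Qed.

Lemma tlik_le_exp o y : tlik o y <= expR (N%:R * theta).
Proof.
rewrite /tlik /typ; case: (leP (llik o y)) => h; last by rewrite mulr0 expR_ge0.
by rewrite mulr1; apply: le_trans (lik_le_exp o y) _; rewrite ler_expR.
Qed.

Lemma sum_lik o : (o < A)%N -> \sum_(y : T.-tuple Y) noise T y * lik o y = 1.
Proof.
move=> oA; rewrite /noise /lik (@sum_pmass_window _ _ _ _ (fun _ => Q1 star)
  (fun i => lr (w i))); last lia.
by rewrite big1 // => i _; apply: sum_lr.
Qed.

Lemma sum_lik_far o o' : (o < A)%N -> (o' < A)%N ->
  ~~ ((o < o' + N) && (o' < o + N))%N ->
  \sum_(y : T.-tuple Y) noise T y * (lik o y * lik o' y) = 1.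
Proof.
move=> oA oA' far; rewrite /noise /lik (@sum_pmass_two_windows _ _ _ _ (fun _ => Q1 star)
  (fun i => lr (w i)) (fun i => lr (w i))) //; try lia.
all: by move=> i _; apply: sum_lr.
Qed.

(** Weighting the noise by [lik] gives the law of the transmitted word. The indicator is at most
    [expR (lam * (llik o y - N%:R * theta))], which factors over letters, and [tail] bounds each
    factor. *)
Lemma sum_atypical o : (o < A)%N ->
  \sum_(y : T.-tuple Y) noise T y * (lik o y * (~~ typ o y)%:R) <= expR (- kap * N%:R).
Proof.
move=> oA.
pose phi i b := lr (w i) b * expR (- lam * (theta - ln (lr (w i) b))).
apply: (@le_trans _ _ (\sum_(y : T.-tuple Y) noise T y * \prod_(i < N) phi i (nth y0 y (o + i)))).
  apply: ler_sum => y _; apply: ler_wpM2l => //.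
  rewrite /phi big_split /= -/(lik o y); apply: ler_wpM2l; first exact: lik_ge0.
  rewrite -expR_sum -mulr_sumr sumrB sumr_const card_ord -/(llik o y) -[theta *+ N]mulr_natl /typ.
  case: (leP (llik o y)) => h; rewrite ?mulr0n ?mulr1n; first exact: expR_ge0.
  apply: le_trans (expR_ge1Dx _); rewrite lerDl mulNr -mulrN opprB mulr_ge0 ?ltW //.
  by rewrite subr_gt0.
rewrite /noise sum_pmass_window //; last lia.
rewrite mulrC mulr_natl -[N in _ *+ N](card_ord N) -sumr_const expR_sum.
apply: ler_prod => i _; apply/andP; split.
  apply: sumr_ge0 => b _; rewrite mulr_ge0 ?Q0 //.
  by rewrite mulr_ge0 ?lr_ge0 ?expR_ge0.
by under eq_bigr do rewrite /phi mulrA mul_lr.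
Qed.

Let delta := expR (- kap * N%:R).

Lemma sum_tlik o : (o < A)%N -> 1 - delta <= \sum_(y : T.-tuple Y) noise T y * tlik o y.
Proof.
move=> oA; rewrite lerBlDr -[X in X <= _](sum_lik oA).
apply: le_trans (lerD (lexx _) (sum_atypical oA)).
rewrite -big_split /=; apply: ler_sum => y _.
by rewrite -mulrDr -mulrDr /tlik; case: typ; rewrite ?addr0 ?add0r !mulr1.
Qed.

(** For overlapping windows one factor is bounded by its cap and the other has total mass one;
    disjoint windows are independent under noise. *)
Lemma sum_tlik2 o o' : (o < A)%N -> (o' < A)%N ->
  \sum_(y : T.-tuple Y) noise T y * (tlik o y * tlik o' y) <=
  1 + (if (o < o' + N)%N && (o' < o + N)%N then expR (N%:R * theta) else 0).
Proof.
move=> oA oA'; case: ifP => [_|/negbT far].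
  apply: (@le_trans _ _ (expR (N%:R * theta) * 1)); last by rewrite mulr1 lerDr.
  rewrite -[X in _ <= _ * X](sum_lik oA') mulr_sumr; apply: ler_sum => y _; rewrite [X in _ <= X]mulrCA.
  apply: ler_wpM2l => //; apply: ler_pM; rewrite ?tlik_ge0 ?tlik_le_exp //.
  exact: tlik_le_lik.
rewrite addr0 -[X in _ <= X](sum_lik_far oA oA' far); apply: ler_sum => y _.
by apply: ler_wpM2l => //; apply: ler_pM; rewrite ?tlik_ge0 ?tlik_le_lik.
Qed.

(** [Z] is the truncated likelihood ratio, against noise, of a word sent at a uniform time. [K]
    measures the contribution of overlapping pairs of windows to its second moment. *)
Let Z (y : seq Y) : R := A%:R^-1 * \sum_(o < A) tlik o y.
Let K : R := N%:R * expR (N%:R * theta) / A%:R.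

Let A0R : 0 < A%:R :> R. Proof. by rewrite ltr0n. Qed.

Lemma sum_mean_tlik : 1 - delta <= \sum_(y : T.-tuple Y) noise T y * Z y.
Proof.
have -> : \sum_(y : T.-tuple Y) noise T y * Z y =
    A%:R^-1 * \sum_(o < A) \sum_(y : T.-tuple Y) noise T y * tlik o y.
  rewrite exchange_big mulr_sumr; apply: eq_bigr => y _.
  by rewrite -mulr_sumr /Z mulrCA.
rewrite ler_pdivlMl //.
apply: (@le_trans _ _ (\sum_(o < A) (1 - delta))).
  by rewrite sumr_const card_ord -[X in _ <= X]mulr_natl.
by apply: ler_sum => o _; apply: sum_tlik.
Qed.

Lemma sum_mean_tlik_sqr : \sum_(y : T.-tuple Y) noise T y * Z y ^+ 2 <= 1 + 2 * K.
Proof.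
have -> : \sum_(y : T.-tuple Y) noise T y * Z y ^+ 2 =
    (A%:R^-1) ^+ 2 * \sum_(o < A) \sum_(o' < A) \sum_(y : T.-tuple Y) noise T y * (tlik o y * tlik o' y).
  under [X in _ = _ * X]eq_bigr do rewrite exchange_big.
  rewrite exchange_big mulr_sumr; apply: eq_bigr => y _.
  rewrite /Z exprMn mulrCA; congr (_ * _).
  rewrite expr2 mulr_suml mulr_sumr; apply: eq_bigr => o _.
  by rewrite !mulr_sumr; apply: eq_bigr => o' _.
have h : \sum_(o < A) \sum_(o' < A) \sum_(y : T.-tuple Y) noise T y * (tlik o y * tlik o' y) <=
   \sum_(o < A) (A%:R + (2 * N)%:R * expR (N%:R * theta)).
  apply: ler_sum => o _.
  apply: le_trans (ler_sum _ (fun o' _ => sum_tlik2 (ltn_ord o) (ltn_ord o'))) _.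
  rewrite big_split /= sumr_const card_ord lerD2l -big_mkcond /=.
  rewrite -(mul1r (expR _)) -mulr_suml mul1r; apply: ler_wpM2r; first exact: expR_ge0.
  exact: sum_near.
rewrite exprVn ler_pdivrMl ?exprn_gt0 //; apply: le_trans h _.
rewrite sumr_const card_ord -[X in X <= _]mulr_natl /K natrM le_eqVlt; apply/orP; left.
by apply/eqP; field; rewrite gt_eqF.
Qed.

(** Change of measure: passing from [lik] to [tlik] costs at most [delta] per offset, and passing
    from [Z] to 1 costs the mean of [|Z - 1|]. *)
Lemma sum_lik_event (e : seq Y -> R) : (forall y, 0 <= e y <= 1) ->
  \sum_(o < A) \sum_(y : T.-tuple Y) noise T y * lik o y * e y <=
  A%:R * (\sum_(y : T.-tuple Y) noise T y * e y + (1 / 8 + 4 * K + 5 * delta)).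
Proof.
move=> e01.
have s1 : \sum_(y : T.-tuple Y) noise T y = 1 by apply: sum_pmass.
have h1 : \sum_(o < A) \sum_(y : T.-tuple Y) noise T y * lik o y * e y <=
    A%:R * (\sum_(y : T.-tuple Y) noise T y * (Z y * e y)) + A%:R * delta.
  have -> : A%:R * delta = \sum_(o < A) delta.
    by rewrite sumr_const card_ord mulr_natl.
  have -> : A%:R * (\sum_(y : T.-tuple Y) noise T y * (Z y * e y)) =
     \sum_(o < A) \sum_(y : T.-tuple Y) noise T y * (tlik o y * e y).
    rewrite exchange_big mulr_sumr; apply: eq_bigr => y _.
    rewrite /Z -mulr_sumr mulrCA; congr (_ * _).
    by rewrite -mulr_suml !mulrA divff ?gt_eqF // mul1r.
  rewrite -big_split; apply: ler_sum => o _ /=.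
  apply: le_trans (lerD (lexx _) (sum_atypical (ltn_ord o))).
  rewrite -big_split; apply: ler_sum => y _ /=.
  rewrite -mulrA -mulrDr; apply: ler_wpM2l => //.
  have /andP[e0 e1] := e01 y; rewrite /tlik.
  case: typ; rewrite /= ?mulr1 ?mulr0 ?addr0 // mul0r add0r.
  by rewrite ler_piMr // lik_ge0.
apply: le_trans h1 _; rewrite -mulrDr ler_pM2l //.
have h2 : \sum_(y : T.-tuple Y) noise T y * (Z y * e y) <=
   \sum_(y : T.-tuple Y) noise T y * e y + (1 / 8 * \sum_(y : T.-tuple Y) noise T y
   + (2 * \sum_(y : T.-tuple Y) noise T y * Z y ^+ 2 - 4 * \sum_(y : T.-tuple Y) noise T y * Z y
   + 2 * \sum_(y : T.-tuple Y) noise T y)).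
  rewrite !mulr_sumr -sumrB -!big_split /=; apply: ler_sum => y _.
  rewrite (_ : _ + _ = noise T y * (e y + (1 / 8 + 2 * (Z y - 1) ^+ 2))); last by ring.
  apply: ler_wpM2l => //; have /andP[e0 e1] := e01 y.
  (* This is [2 * (u - 1 / 4) ^+ 2 >= 0] with [u = |Z y - 1|]; it replaces Cauchy-Schwarz and its
     square root. The mean of [(Z - 1) ^+ 2] is at most [2 * K + 2 * delta]. *)
  have h : `|Z y - 1| <= 1 / 8 + 2 * (Z y - 1) ^+ 2.
    rewrite -[(Z y - 1) ^+ 2]ger0_norm ?sqr_ge0 // normrX.
    have := sqr_ge0 (`|Z y - 1| - 1 / 4); set u := `|_|; rewrite expr2 => ?.
    by rewrite expr2; nra.
  rewrite -lerBlDl; apply: le_trans h.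
  rewrite (_ : _ - _ = (Z y - 1) * e y); last by ring.
  apply: le_trans (ler_norm _) _; rewrite normrM (ger0_norm e0).
  by rewrite ler_piMr.
have h3 := sum_mean_tlik; have h4 := sum_mean_tlik_sqr; rewrite s1 in h2; lra.
Qed.

End Noise.

Lemma pmass_law (R : realType) (X Y : finType) (Q : X -> Y -> R) (star : X) (y0 : Y)
    (N M : nat) (C : Defs.code X Y N M) (m : 'I_M) (o T : nat) (y : seq Y) :
  (forall x b, Q star b = 0 -> Q x b = 0) -> (o + N <= T)%N ->
  pmass y0 (law Q star C m o.+1) T y =
  pmass y0 (fun _ => Q star) T y * lik Q star y0 N (nth star (cw C m)) o y.
Proof.
move=> ac oT; rewrite /lik -(prod_window
  (fun i => lr Q star (nth star (cw C m) i) (nth y0 y (o + i))) oT) -big_split /=.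
apply: eq_bigr => j _; rewrite /law /inp addSn !ltnS subSS.
by case: ifP => h; rewrite ?mulr1 // subnKC ?mul_lr //; case/andP: h.
Qed.

(** Decoding events for different messages are disjoint, so their noise probabilities sum to at most
    1. After the change of measure the mean probability of correct decoding is at most
    [1 / M + beta], hence at most [1 / 2 + beta]. *)
Lemma error_prob_lower_bound (R : realType) (X Y : finType) (Q : X -> Y -> R) (star : X)
    (theta lam kap : R) (N M : nat) (C : Defs.code X Y N M) (A : nat) (eps : R) :
  is_channel Q -> (forall x b, Q star b = 0 -> Q x b = 0) -> 0 < lam ->
  (forall x, \sum_b Q x b * expR (- lam * (theta - ln (lr Q star x b))) <= expR (- kap)) ->
  (2 <= M)%N -> (0 < A)%N -> (error_prob Q star C A <= eps%:E)%E ->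
  1 / 2 <= eps + (1 / 8 + 4 * (N%:R * expR (N%:R * theta) / A%:R) + 5 * expR (- kap * N%:R)).
Proof.
move=> Qch ac lam0 tail M2 A0 err.
have [y0 _|Y0] := pickP (@predT Y); last first.
  by have := Qch.2 star; rewrite big1 => [/esym/eqP|y]; [rewrite oner_eq0 | have := Y0 y].
set beta := 1 / 8 + _ + _.
have A0R : 0 < A%:R :> R by rewrite ltr0n.
have M0R : 2 <= M%:R :> R by rewrite ler_nat.
pose u t := \sum_(m < M) \sum_(1 <= l < A.+1) p_correct Q star C m l t.
have u0 t : 0 <= u t by do 2 (apply: sumr_ge0 => ? _); apply: p_correct_ge0.
have uT T : \sum_(t < T) u t <= A%:R * (1 + M%:R * beta).
  (* The horizon is enlarged so that it contains every possible transmission window. *)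
  apply: (@le_trans _ _ (\sum_(t < T + (A + N)) u t)).
    by rewrite big_split_ord /= lerDl sumr_ge0.
  set T' := (T + (A + N))%N.
  pose e m (y : seq Y) : R :=
    \sum_(t < T') (first_stop C (take t y) && (dec C (take t y) == m))%:R.
  have st (y : T'.-tuple Y) : \sum_(m < M) e m y <= 1.
    apply: le_trans (sum_first_stop R C y).
    rewrite exchange_big; apply: ler_sum => t _ /=.
    case: first_stop; last by rewrite big1.
    by apply: sum_indicator_le1 => i j /eqP <- /eqP.
  (* [sum_lik_event] asks for values in the unit interval on every list, so [e] is cut off outside
     the length [T']. *)
  pose e' m (y : seq Y) : R := if size y == T' then e m y else 0.
  have e0 m y : 0 <= e m y by apply: sumr_ge0.
  have e'01 m y : 0 <= e' m y <= 1.
    rewrite /e'; case: eqP => [sz|_]; last by rewrite lexx ler01.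
    rewrite e0 /=; have sz' : size y == T' by rewrite sz.
    apply: le_trans (st (Tuple sz')).
    by rewrite [X in _ <= X](bigD1 m) //= lerDl sumr_ge0.
  have E : \sum_(t < T') u t = \sum_(m < M) \sum_(o < A) \sum_(y : T'.-tuple Y)
     pmass y0 (fun _ => Q star) T' y * lik Q star y0 N (nth star (cw C m)) o y * e' m y.
    rewrite /u exchange_big; apply: eq_bigr => m _ /=.
    rewrite exchange_big /= big_add1 /= big_mkord; apply: eq_bigr => o _.
    rewrite (partial_sum_correct star y0 Qch); apply: eq_bigr => y _.
    rewrite /e' size_tuple eqxx; congr (_ * _); apply: pmass_law => //.
    by rewrite /T'; have := ltn_ord o; lia.
  rewrite E.
  apply: (@le_trans _ _ (\sum_(m < M) A%:R *
      (\sum_(y : T'.-tuple Y) pmass y0 (fun _ => Q star) T' y * e' m y + beta))).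
    apply: ler_sum => m _; apply: (sum_lik_event y0 Qch ac lam0 tail) => //.
    by rewrite /T'; lia.
  rewrite -mulr_sumr ler_pM2l // big_split /= sumr_const card_ord mulr_natl lerD2r.
  rewrite exchange_big /= -[X in _ <= X](@sum_pmass _ _ y0 _ (fun _ => Qch.2 star) T').
  apply: ler_sum => y _; rewrite -mulr_sumr; apply: ler_piMr.
    by apply: pmass_ge0 => *; apply: Qch.1.
  by rewrite /e' size_tuple eqxx st.
pose s m l := (\sum_(t <oo) (p_correct Q star C m l t)%:E)%E.
have sfin m l : s m l = (fine (s m l))%:E.
  rewrite fineK // ge0_fin_numE.
    by apply: le_lt_trans (series_correct_le1 star y0 Qch C m l) _; rewrite ltry.
  by apply: nneseries_ge0 => n _ _; rewrite lee_fin p_correct_ge0.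
have su : (\sum_(m < M) \sum_(1 <= l < A.+1) s m l <= (A%:R * (1 + M%:R * beta))%:E)%E.
  rewrite /s; under eq_bigr => m _.
    rewrite -nneseries_sum; last by move=> *; rewrite lee_fin p_correct_ge0.
    over.
  rewrite -nneseries_sum; last first.
    by move=> *; apply: sume_ge0 => *; rewrite lee_fin p_correct_ge0.
  under eq_eseriesr => t _.
    under eq_bigr do rewrite sumEFin.
    rewrite sumEFin.
    over.
  exact: nneseries_le.
move: err su; rewrite /error_prob /p_err.
under eq_bigr do under eq_bigr do rewrite -/(s _ _) sfin -EFinB.
under eq_bigr do rewrite sumEFin.
rewrite sumEFin -EFinM lee_fin => err.
under eq_bigr do under eq_bigr do rewrite sfin.
under eq_bigr do rewrite sumEFin.
rewrite sumEFin lee_fin => su.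
move: err; rewrite ler_pdivrMl; last by rewrite ltr0n muln_gt0 A0; lia.
under eq_bigr do rewrite sumrB.
rewrite sumrB.
have -> : \sum_(m < M) \sum_(1 <= l < A.+1) 1 = (A * M)%:R :> R.
  under eq_bigr do rewrite sumr_const_nat subn1 /=.
  by rewrite sumr_const card_ord -mulrnA.
rewrite natrM => err.
have : A%:R * (M%:R * (1 - eps - beta)) <= A%:R * 1 by lra.
rewrite ler_pM2l // => h.
rewrite leNgt; apply/negP => h'.
have : 0 <= (M%:R - 2) * (1 - eps - beta) by apply: mulr_ge0; lra.
lra.
Qed.

(** Writing [expR (c * N%:R)] as the square of [expR (c * N%:R / 2)] bounds it below by a quadratic
    in [N]; [b] is chosen so that this quadratic times [e] is at least [2 * N]. *)
Lemma poly_expR_small (R : realType) (c e : R) : 0 < c -> 0 < e ->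
  exists N0 : nat, forall N, (N0 <= N)%N -> (N%:R + 1) * expR (- c * N%:R) <= e.
Proof.
move=> c0 e0; pose b := 8 / (c ^+ 2 * e).
have ce0 : 0 < c ^+ 2 * e by rewrite mulr_gt0 // exprn_gt0.
have b0 : 0 <= b by rewrite divr_ge0 // ltW.
exists (Num.bound b).+1 => N hN.
have N1 : 1 <= N%:R :> R by rewrite ler1n; apply: leq_trans hN.
have bN : b <= N%:R.
  by apply: ltW; apply: lt_le_trans (archi_boundP b0) _; rewrite ler_nat ltnW.
have h8 : 8 <= N%:R * (c ^+ 2 * e) by rewrite -ler_pdivrMr.
rewrite mulNr expRN ler_pdivrMr ?expR_gt0 //.
have -> : c * N%:R = (c * N%:R / 2) + (c * N%:R / 2) by field.
rewrite expRD -expr2.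
have u0 : 0 < c * N%:R / 2 by rewrite divr_gt0 // mulr_gt0 //; lra.
have h : (c * N%:R / 2) ^+ 2 <= expR (c * N%:R / 2) ^+ 2.
  rewrite lerXn2r ?nnegrE ?expR_ge0 //; first exact: ltW.
  by have := expR_ge1Dx (c * N%:R / 2); lra.
apply: (@le_trans _ _ (e * (c * N%:R / 2) ^+ 2)); last by rewrite ler_pM2l.
have -> : e * (c * N%:R / 2) ^+ 2 = N%:R * (N%:R * (c ^+ 2 * e)) / 4 by field.
have : N%:R * 8 <= N%:R * (N%:R * (c ^+ 2 * e)) by rewrite ler_pM2l //; lra.
lra.
Qed.

(** The witness is the ceiling of the exponential, obtained from its truncation. *)
Lemma async_level_exists (R : realType) (a eps : R) (N : nat) :
  exists A, async_level a eps N A.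
Proof.
rewrite /async_level; set x := expR _.
have x0 : 0 < x by apply: expR_gt0.
have /andP[h1 h2] := truncn_itv (ltW x0).
have [e|ne] := eqVneq x (Num.trunc x)%:R.
  by exists (Num.trunc x); rewrite -e lexx andbT; lra.
exists (Num.trunc x).+1; rewrite -natr1 addrK.
by rewrite lt_neqAle eq_sym ne h1 /= natr1 ltW.
Qed.

(** If [a] exceeded all the divergences, these would be finite, which gives absolute continuity, and
    a threshold could be fitted between them and [a]. *)
Lemma achievable_le_KL (R : realType) (X Y : finType) (Q : X -> Y -> R) (star : X) (a : R) :
  is_channel Q -> achievable Q star 0 a ->
  (a%:E <= \big[maxe/-oo]_(x : X) KL (Q x) (Q star))%E.
Proof.
move=> Qch ach; rewrite leNgt; apply/negP => lt.
have Klt x : (KL (Q x) (Q star) < a%:E)%E by apply: le_lt_trans lt; apply: le_bigmax.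
have ac x b : Q star b = 0 -> Q x b = 0.
  move=> q0; apply/eqP/negPn/negP => qx.
  suff K : KL (Q x) (Q star) = +oo%E by have := Klt x; rewrite K.
  apply/eqP; rewrite /KL esum_eqy.
    by apply/existsP; exists b; rewrite (negPf qx) q0 !eqxx.
  by move=> i _; case: ifP => // _; case: ifP.
pose k x := \sum_y Q x y * ln (lr Q star x y).
have kE x : KL (Q x) (Q star) = (k x)%:E.
  rewrite /KL -sumEFin; apply: eq_bigr => y _.
  have [->|n] := eqVneq (Q x y) 0; first by rewrite mul0r.
  by have [e|//] := eqVneq (Q star y) 0; move: n; rewrite (ac _ _ e) eqxx.
pose d := \big[Order.min/1]_x (a - k x).
have d0 : 0 < d.
  by apply: lt_bigmin => // x _; have := Klt x; rewrite kE lte_fin subr_gt0.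
have dk x : d <= a - k x by apply: bigmin_le.
(* [theta] is at least [d / 2] above every divergence and [d / 2] below [a]; with [eps <= d / 4] the
   exponent [a - eps] still beats [theta] by [d / 4]. *)
pose theta := a - d / 2.
have d20 : 0 < d / 2 by lra.
have dG x : d / 2 <= \sum_y Q x y * (theta - ln (lr Q star x y)).
  under eq_bigr do rewrite mulrBr.
  by rewrite sumrB -mulr_suml Qch.2 mul1r -/(k x) /theta; have := dk x; lra.
have [lam [kap [lam0 kap0 tail]]] := exp_moment_lt1 d20 Qch.1 Qch.2 dG.
pose eps := Order.min (d / 4) (1 / 8).
have eps0 : 0 < eps by rewrite lt_min; apply/andP; split; lra.
have eps1 : eps <= 1 / 8 by rewrite ge_min lexx orbT.
have eps2 : eps <= d / 4 by rewrite ge_min lexx.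
have d40 : 0 < d / 4 by lra.
(* The final contradiction is [1 / 2 <= 1 / 8 + 1 / 8 + 9 / 80]. *)
have e0 : 0 < 1 / 80 :> R by lra.
have [N0 H0] := ach eps eps0.
have [N1 H1] := poly_expR_small d40 e0.
have [N2 H2] := poly_expR_small kap0 e0.
pose N := (N0 + N1 + N2)%N.
have h1 := H1 N (leq_trans (leq_addl N0 N1) (leq_addr N2 _)).
have h2 := H2 N (leq_addl _ _).
have [|M [C [M2 good]]] := H0 N; first by rewrite /N -addnA leq_addr.
have [A lev] := async_level_exists a eps N.
have [_ err] := good A lev.
have /andP[_ AE] := lev.
have A0 : 0 < A%:R :> R by apply: lt_le_trans AE; apply: expR_gt0.
have A0n : (0 < A)%N by rewrite -(ltr0n R).
have := error_prob_lower_bound Qch ac lam0 tail M2 A0n err.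
have N0R : 0 <= N%:R :> R by [].
have h3 : N%:R * expR (N%:R * theta) / A%:R <= 1 / 80.
  apply: le_trans h1; rewrite ler_pdivrMr //.
  apply: (@le_trans _ _ (((N%:R + 1) * expR (- (d / 4) * N%:R)) * expR ((a - eps) * N%:R))).
    rewrite -mulrA -expRD; apply: ler_pM; rewrite ?expR_ge0 ?lerDl //.
    rewrite ler_expR -mulrDl mulrC; apply: ler_wpM2r => //; rewrite /theta; lra.
  by rewrite ler_pM2l // mulr_gt0 ?expR_gt0 //; lra.
have h4 : expR (- kap * N%:R) <= 1 / 80.
  by apply: le_trans h2; rewrite ler_peMl ?expR_ge0 // lerDr.
lra.
Qed.

(** * Achievability *)

Section FixedStop.
Variables (R : realType) (X Y : finType) (Q : X -> Y -> R) (star : X) (y0 : Y).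
Hypothesis Qch : is_channel Q.
Variables (N M T : nat) (C : Defs.code X Y N M).
Hypothesis T0 : (0 < T)%N.
Hypothesis stopE : forall y, stop C y = (size y == T).

Lemma first_stop_fixed (y : T.-tuple Y) : first_stop C y.
Proof.
rewrite /first_stop stopE size_tuple T0 eqxx /=; apply/forallP => s.
have sT : (s < T)%N by have := ltn_ord s; rewrite ?size_tuple.
rewrite stopE size_takel; last by rewrite size_tuple ltnW.
by apply/implyP => _; rewrite neq_ltn sT.
Qed.

(** Keeping only the term at time [T] of the series of correct decodings can only increase the error
    bound. *)
Lemma p_err_fixed m l : (p_err Q star C m l <=
  (\sum_(y : T.-tuple Y) pmass y0 (law Q star C m l) T y * (dec C y != m)%:R)%:E)%E.
Proof.
have le : ((p_correct Q star C m l T)%:E <= \sum_(t <oo) (p_correct Q star C m l t)%:E)%E.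
  apply: le_trans (nneseries_lim_ge T.+1 _).
    rewrite big_nat_recr //= leeDr //; apply: sume_ge0 => t _.
    by rewrite lee_fin p_correct_ge0.
  by move=> n _ _; rewrite lee_fin p_correct_ge0.
apply: (@le_trans _ _ (1 - (p_correct Q star C m l T)%:E)%E); first exact: leeB.
rewrite -EFinB lee_fin (p_correctE Q star y0) lerBlDr.
rewrite -[X in X <= _](sum_pmass y0 (sum_law star Qch C m l) T) -big_split /=.
apply: ler_sum => y _; rewrite first_stop_fixed -mulrDr /=.
by case: (_ == _); rewrite ?addr0 ?add0r mulr1.
Qed.

End FixedStop.

(** * Random coding at a fixed blocklength *)

Section RandomCoding.
Variables (R : realType) (X Y : finType) (Q : X -> Y -> R) (star : X) (y0 : Y).
Hypothesis Qch : is_channel Q.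
Variables (xs : X) (P : X -> R) (g : Y -> R) (h : X -> Y -> R).
Hypothesis P0 : forall x, 0 <= P x.
Hypothesis P1 : \sum_x P x = 1.
Variables (c gam lam1 lam2 kap1 kap2 : R).
Hypothesis lam10 : 0 < lam1.
Hypothesis lam20 : 0 < lam2.
Hypothesis g1 : \sum_b Q star b * expR (g b) <= 1.
Hypothesis h1 : forall b, \sum_x P x * expR (h x b) <= 1.
Hypothesis tail1 : \sum_b Q xs b * expR (- lam1 * (g b - c)) <= expR (- kap1).
Hypothesis tail2 :
  \sum_x P x * \sum_b Q x b * expR (- lam2 * (h x b - gam)) <= expR (- kap2).
Variables (n1 n2 M A : nat).
Hypothesis n20 : (0 < n2)%N.
Hypothesis A0 : (0 < A)%N.
Variable m0 : 'I_M.

Let Q0 := Qch.1.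
Let Q1 := Qch.2.
Let N := (n1 + n2)%N.
Let T := (A + N)%N.
Local Notation V := (n2.-tuple X).
Local Notation book := {ffun 'I_M -> n2.-tuple X}.

Definition word (u : V) (i : nat) : X := if (i < n1)%N then xs else nth xs u (i - n1).

Definition sync_score o (y : seq Y) : R := \sum_(i < n1) g (nth y0 y (o + i)).
Definition info_score (u : V) o (y : seq Y) : R :=
  \sum_(i < n2) h (nth xs u i) (nth y0 y (o + n1 + i)).
Definition pass (u : V) o (y : seq Y) : bool :=
  (n1%:R * c <= sync_score o y) && (n2%:R * gam <= info_score u o y).

(** At time [T] every candidate window has been observed in full. The decoder keeps a message only;
    [m0] is a default for outputs where no test is passed. *)
Definition random_code (f : book) : Defs.code X Y N M := {|
  cw := fun m => [tuple word (f m) i | i < N];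
  stop := fun y => size y == T;
  dec := fun y => odflt m0 [pick m | [exists o : 'I_A, pass (f m) o y]] |}.

Definition sent_law (u : V) (o j : nat) (b : Y) : R :=
  Q (if (o <= j < o + N)%N then word u (j - o) else star) b.

Lemma sent_law_ge0 u o j b : 0 <= sent_law u o j b. Proof. exact: Q0. Qed.
Lemma sum_sent_law u o j : \sum_b sent_law u o j b = 1. Proof. exact: Q1. Qed.

Lemma law_random_code f m o : law Q star (random_code f) m o.+1 = sent_law (f m) o.
Proof.
apply/funext => j; apply/funext => b; rewrite /law /sent_law /inp addSn !ltnS subSS.
case: ifP => // hj; congr (Q _ _); rewrite /random_code /=.
have jN : (j - o < N)%N by case/andP: hj => ? ?; rewrite ltn_subLR.
by rewrite (nth_map (Ordinal jN)) ?size_enum_ord // nth_enum_ord.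
Qed.

Lemma sent_law_sync u o i : (i < n1)%N -> sent_law u o (o + i) = Q xs.
Proof.
move=> hi; apply/funext => b; rewrite /sent_law leq_addr ltn_add2l ltn_addr //=.
by rewrite addKn /word hi.
Qed.

Lemma sent_law_info u o i : (i < n2)%N -> sent_law u o (o + n1 + i) = Q (nth xs u i).
Proof.
move=> hi; apply/funext => b; rewrite /sent_law -addnA leq_addr !ltn_add2l hi /=.
by rewrite addKn /word ltnNge leq_addr /= addKn.
Qed.

Let near (o o' : nat) := (o < o' + N)%N && (o' < o + N)%N.

Lemma sent_law_far u o o' i : ~~ near o o' -> (i < n1)%N -> sent_law u o (o' + i) = Q star.
Proof.
move=> far hi; apply/funext => b; rewrite /sent_law ifF //.
by move: far; rewrite /near /N; lia.
Qed.

Let sent u o (y : seq Y) : R := pmass y0 (sent_law u o) T y.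
Let sent_ge0 u o y : 0 <= sent u o y.
Proof. by apply: pmass_ge0 => *; apply: sent_law_ge0. Qed.

Let pr (u : V) : R := pmass xs (fun _ => P) n2 u.
Let pr_ge0 u : 0 <= pr u. Proof. exact: pmass_ge0. Qed.
Let sum_pr : \sum_(u : V) pr u = 1. Proof. exact: sum_pmass. Qed.

(** Exponential majorants of the two ways of missing the true window and of the two tests passed by
    a false one. In [false1] an overlapping window gets the trivial bound 1, because its first test
    may see part of the transmitted word. *)
Let miss1 o (y : seq Y) : R := \prod_(i < n1) expR (- lam1 * (g (nth y0 y (o + i)) - c)).
Let miss2 (u : V) o (y : seq Y) : R :=
  \prod_(i < n2) expR (- lam2 * (h (nth xs u i) (nth y0 y (o + n1 + i)) - gam)).
Let false1 o o' (y : seq Y) : R :=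
  if near o o' then 1 else \prod_(i < n1) expR (g (nth y0 y (o' + i))) * expR (- (n1%:R * c)).
Let false2 (u : V) o (y : seq Y) : R :=
  \prod_(i < n2) expR (h (nth xs u i) (nth y0 y (o + n1 + i))) * expR (- (n2%:R * gam)).

Lemma not_pass_le u o y : (~~ pass u o y)%:R <= miss1 o y + miss2 u o y.
Proof.
have E1 : miss1 o y = expR (lam1 * (n1%:R * c - sync_score o y)).
  rewrite /miss1 -expR_sum -mulr_sumr sumrB sumr_const card_ord -[c *+ n1]mulr_natl.
  by congr expR; rewrite mulNr -mulrN opprB.
have E2 : miss2 u o y = expR (lam2 * (n2%:R * gam - info_score u o y)).
  rewrite /miss2 -expR_sum -mulr_sumr sumrB sumr_const card_ord -[gam *+ n2]mulr_natl.
  by congr expR; rewrite mulNr -mulrN opprB.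
have ex (z : R) : 0 <= z -> 1 <= expR z by move=> ?; have := expR_ge1Dx z; lra.
rewrite E1 E2 /pass negb_and -!ltNge.
case: (ltP (sync_score o y)) => s1 /=.
  rewrite -[X in X <= _]addr0; apply: lerD (expR_ge0 _); apply: ex.
  by rewrite mulr_ge0 ?ltW // subr_gt0.
case: (ltP (info_score u o y)) => s2 /=; last by rewrite addr_ge0 ?expR_ge0.
rewrite -[X in X <= _]add0r; apply: lerD (expR_ge0 _) _; apply: ex.
by rewrite mulr_ge0 ?ltW // subr_gt0.
Qed.

Lemma pass_le u o o' y : (pass u o' y)%:R <= false1 o o' y * false2 u o' y.
Proof.
have E2 : false2 u o' y = expR (info_score u o' y - n2%:R * gam).
  by rewrite /false2 -expR_sum -expRD.
have E1 : false1 o o' y = if near o o' then 1 else expR (sync_score o' y - n1%:R * c).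
  by rewrite /false1 -expR_sum -expRD.
have ex (z : R) : 0 <= z -> 1 <= expR z by move=> ?; have := expR_ge1Dx z; lra.
rewrite E1 E2 /pass.
case: (leP (n1%:R * c)) => s1 /=; last by rewrite mulr_ge0 ?expR_ge0 //; case: ifP.
case: (leP (n2%:R * gam)) => s2 /=; last by rewrite mulr_ge0 ?expR_ge0 //; case: ifP.
rewrite -[X in X <= _]mulr1; apply: ler_pM => //; last by apply: ex; rewrite subr_ge0.
by case: ifP => // _; apply: ex; rewrite subr_ge0.
Qed.

(** Pointwise union bound: either the true pair fails a test, or another message passes somewhere.
    The sent message passing at a wrong offset causes no error. *)
Lemma dec_err_le (f : book) m (o : 'I_A) y : (dec (random_code f) y != m)%:R <=
  miss1 o y + miss2 (f m) o y +
  \sum_(m' | m' != m) \sum_(o' < A) false1 o o' y * false2 (f m') o' y.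
Proof.
have nn m' (o' : 'I_A) : 0 <= false1 o o' y * false2 (f m') o' y.
  by apply: le_trans (pass_le (f m') o o' y).
have nns : 0 <= \sum_(m' | m' != m) \sum_(o' < A) false1 o o' y * false2 (f m') o' y.
  by do 2 (apply: sumr_ge0 => ? _).
have nn1 : 0 <= miss1 o y + miss2 (f m) o y by apply: le_trans (not_pass_le (f m) o y).
have [e|ne] := eqVneq (dec (random_code f) y) m; first by rewrite addr_ge0.
case ps : (pass (f m) o y); last first.
  by have := not_pass_le (f m) o y; rewrite ps /= => le; rewrite -[X in X <= _]addr0; apply: lerD.
move: ne; rewrite /random_code /=; case: pickP => /= [m' /existsP [j ps'] ne | H].
  rewrite -[X in X <= _]add0r; apply: lerD => //.
  rewrite (bigD1 m') //= (bigD1 j) //= -addrA -[X in X <= _]addr0; apply: lerD.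
    by have := pass_le (f m') o j y; rewrite ps'.
  by rewrite addr_ge0 //; do ?(apply: sumr_ge0 => ? _).
by have /existsP[] := negbT (H m); exists o.
Qed.


Lemma sum_miss1 u (o : 'I_A) :
  \sum_(y : T.-tuple Y) sent u o y * miss1 o y <= expR (- kap1 * n1%:R).
Proof.
have oT : (o + n1 <= T)%N by rewrite /T /N; have := ltn_ord o; lia.
rewrite /sent /miss1 (sum_pmass_window y0 (sum_sent_law u o)
  (fun _ b => expR (- lam1 * (g b - c))) oT).
rewrite mulrC mulr_natl -[n1 in _ *+ n1](card_ord n1) -sumr_const expR_sum.
apply: ler_prod => i _; rewrite sent_law_sync // tail1 andbT.
by apply: sumr_ge0 => b _; rewrite mulr_ge0 ?Q0 ?expR_ge0.
Qed.

(** Averaging over the random word as well as over the channel makes the letters independent and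
    identically distributed, so [tail2] applies to each. *)
Lemma sum_miss2 (o : 'I_A) :
  \sum_(u : V) pr u * \sum_(y : T.-tuple Y) sent u o y * miss2 u o y <= expR (- kap2 * n2%:R).
Proof.
have oT : (o + n1 + n2 <= T)%N by rewrite /T /N; have := ltn_ord o; lia.
pose k x := \sum_b Q x b * expR (- lam2 * (h x b - gam)).
have -> : \sum_(u : V) pr u * \sum_(y : T.-tuple Y) sent u o y * miss2 u o y =
    \sum_(u : V) \prod_(i < n2) (P (nth xs u i) * k (nth xs u i)).
  apply: eq_bigr => u _; rewrite big_split; congr (_ * _).
  rewrite /sent /miss2 (sum_pmass_window y0 (sum_sent_law u o)
    (fun i b => expR (- lam2 * (h (nth xs u i) b - gam))) oT).
  by apply: eq_bigr => i _; rewrite sent_law_info.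
rewrite (sum_tuple_prod xs n2 (fun _ x => P x * k x)).
rewrite mulrC mulr_natl -[n2 in _ *+ n2](card_ord n2) -sumr_const expR_sum.
apply: ler_prod => i _; rewrite tail2 andbT; apply: sumr_ge0 => x _.
by rewrite mulr_ge0 //; apply: sumr_ge0 => b _; rewrite mulr_ge0 ?Q0 ?expR_ge0.
Qed.

(* The bound holds for every fixed output, hence whatever the overlap between
   the window at [o] and the transmitted word. *)
Lemma sum_false2 o y : \sum_(v : V) pr v * false2 v o y <= expR (- (n2%:R * gam)).
Proof.
under eq_bigr do rewrite /false2 mulrA /pr /pmass -big_split /=.
rewrite -mulr_suml (sum_tuple_prod xs n2
  (fun i x => P x * expR (h x (nth y0 y (o + n1 + i))))).
rewrite ler_piMl ?expR_ge0 //; apply: prodr_ile1 => i _.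
by rewrite h1 andbT; apply: sumr_ge0 => x _; rewrite mulr_ge0 ?expR_ge0.
Qed.

Lemma false1_ge0 o o' y : 0 <= false1 o o' y.
Proof.
rewrite /false1; case: ifP => // _; rewrite mulr_ge0 ?expR_ge0 //.
by apply: prodr_ge0 => i _; apply: expR_ge0.
Qed.

Lemma sum_false1 u o (o' : 'I_A) : \sum_(y : T.-tuple Y) sent u o y * false1 o o' y <=
  (if near o o' then 1 else 0) + (if near o o' then 0 else expR (- (n1%:R * c))).
Proof.
rewrite /false1; case: ifP => [_|/negbT far].
  under eq_bigr do rewrite mulr1.
  by rewrite sum_pmass ?addr0 // => j; apply: sum_sent_law.
have oT : (o' + n1 <= T)%N by rewrite /T /N; have := ltn_ord o'; lia.
under eq_bigr do rewrite mulrA.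
rewrite -mulr_suml add0r /sent (sum_pmass_window y0 (sum_sent_law u o)
  (fun _ b => expR (g b)) oT) ler_piMl ?expR_ge0 //; apply: prodr_ile1 => i _.
rewrite sent_law_far // g1 andbT.
by apply: sumr_ge0 => x _; rewrite mulr_ge0 ?expR_ge0 ?Q0.
Qed.

Lemma sum_far (o : 'I_A) (al : R) : 0 <= al ->
  \sum_(o' < A) ((if near o o' then 1 else 0) + (if near o o' then 0 else al)) <=
  (2 * N)%:R + (A%:R - 1) * al.
Proof.
move=> al0; rewrite big_split /=; apply: lerD.
  by rewrite -big_mkcond; apply: sum_near.
(* The true offset counts among the near ones, leaving at most [A - 1] far ones; [async_level]
   bounds precisely [A%:R - 1] from above. *)
have nr : near o o by rewrite /near /N; lia.
rewrite (bigD1 o) //= nr add0r.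
apply: (@le_trans _ _ (\sum_(o' < A | o' != o) al)).
  by apply: ler_sum => o' _; case: ifP.
rewrite sumr_const -[X in X <= _]mulr_natl cardC1 card_ord ler_wpM2r //.
by rewrite -[in X in _ <= X](prednK A0) -natr1 addrK.
Qed.

Let al : R := expR (- (n1%:R * c)).
Let be : R := expR (- (n2%:R * gam)).
Let bound : R := expR (- kap1 * n1%:R) + expR (- kap2 * n2%:R) +
  M%:R * (((2 * N)%:R + (A%:R - 1) * al) * be).

(** The output depends on the codebook only through [f m], which is independent of every other word
    [f m']. *)
Lemma mean_error (m : 'I_M) (o : 'I_A) :
  \sum_(f : book) book_weight pr f *
    (\sum_(y : T.-tuple Y) sent (f m) o y * (dec (random_code f) y != m)%:R) <= bound.
Proof.
have w0 (f : book) : 0 <= book_weight pr f by apply: prodr_ge0.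
pose G1 u := \sum_(y : T.-tuple Y) sent u o y * (miss1 o y + miss2 u o y).
pose G2 u v := \sum_(y : T.-tuple Y) \sum_(o' < A) sent u o y * (false1 o o' y * false2 v o' y).
apply: (@le_trans _ _ (\sum_(f : book) (book_weight pr f * G1 (f m) +
     \sum_(m' | m' != m) book_weight pr f * G2 (f m) (f m')))).
  apply: ler_sum => f _; rewrite -mulr_sumr -mulrDr; apply: ler_wpM2l => //.
  rewrite exchange_big -big_split; apply: ler_sum => y _ /=.
  under eq_bigr do rewrite -mulr_sumr.
  by rewrite -mulr_sumr -mulrDr; apply: ler_wpM2l => //; apply: dec_err_le.
rewrite big_split /= exchange_big /= (sum_book1 sum_pr); apply: lerD.
  rewrite /G1.
  have -> : \sum_(u : V) pr u * (\sum_(y : T.-tuple Y) sent u o y * (miss1 o y + miss2 u o y)) =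
     \sum_(u : V) pr u * (\sum_(y : T.-tuple Y) sent u o y * miss1 o y) +
     \sum_(u : V) pr u * (\sum_(y : T.-tuple Y) sent u o y * miss2 u o y).
    rewrite -big_split; apply: eq_bigr => u _ /=; rewrite -mulrDr; congr (_ * _).
    by rewrite -big_split; apply: eq_bigr => y _ /=; rewrite -mulrDr.
  apply: lerD (sum_miss2 o).
  rewrite -[X in _ <= X]mul1r -[X in _ <= X * _]sum_pr mulr_suml.
  by apply: ler_sum => u _; apply: ler_wpM2l => //; apply: sum_miss1.
have be0 : 0 <= be by apply: expR_ge0.
have al0 : 0 <= al by apply: expR_ge0.
have A1 : 0 <= A%:R - 1 :> R by rewrite subr_ge0 ler1n.
have b0 : 0 <= ((2 * N)%:R + (A%:R - 1) * al) * be.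
  by rewrite mulr_ge0 // addr_ge0 // mulr_ge0.
rewrite [X in _ <= X]mulr_natl -[X in _ <= _ *+ X](card_ord M) -sumr_const.
rewrite [X in X <= _]big_mkcond; apply: ler_sum => m' _; case: ifP => // ne.
rewrite (sum_book2 sum_pr) //.
rewrite -[X in _ <= X]mul1r -[X in _ <= X * _]sum_pr mulr_suml.
apply: ler_sum => u _; apply: ler_wpM2l => //; rewrite /G2.
(* The average over the false word is moved innermost, with the output fixed, as [sum_false2]
   requires. *)
have -> : \sum_(v : V) pr v * (\sum_(y : T.-tuple Y) \sum_(o' < A)
     sent u o y * (false1 o o' y * false2 v o' y)) =
  \sum_(o' < A) \sum_(y : T.-tuple Y) (sent u o y * false1 o o' y) *
     \sum_(v : V) pr v * false2 v o' y.
  under eq_bigr do rewrite exchange_big mulr_sumr.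
  rewrite exchange_big; apply: eq_bigr => o' _ /=.
  under eq_bigr do rewrite mulr_sumr.
  rewrite exchange_big; apply: eq_bigr => y _ /=.
  by rewrite mulr_sumr; apply: eq_bigr => v _; ring.
apply: le_trans (ler_wpM2r be0 (sum_far o al0)); rewrite mulr_suml.
apply: ler_sum => o' _.
apply: le_trans (ler_wpM2r be0 (sum_false1 u o o')); rewrite mulr_suml.
apply: ler_sum => y _; apply: ler_wpM2l; last exact: sum_false2.
by rewrite mulr_ge0 // false1_ge0.
Qed.

Lemma random_coding : exists C : Defs.code X Y (n1 + n2) M, (error_prob Q star C A <= bound%:E)%E.
Proof.
pose E (f : book) := (A * M)%:R^-1 * \sum_(m < M) \sum_(o < A)
  \sum_(y : T.-tuple Y) sent (f m) o y * (dec (random_code f) y != m)%:R.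
have M0 : (0 < M)%N by apply: leq_ltn_trans (ltn_ord m0).
have AM : 0 < (A * M)%:R :> R by rewrite ltr0n muln_gt0 A0.
have [f Ef] : exists f : book, E f <= bound.
  apply: (@weighted_mean_exists R _ (@book_weight R _ pr M) E).
  - by move=> f; apply: prodr_ge0.
  - exact: sum_book_weight.
  have -> : \sum_f book_weight pr f * E f = (A * M)%:R^-1 * \sum_(m < M) \sum_(o < A)
     \sum_f book_weight pr f * (\sum_(y : T.-tuple Y) sent (f m) o y * (dec (random_code f) y != m)%:R).
    under [X in _ = _ * X]eq_bigr do rewrite exchange_big.
    rewrite exchange_big mulr_sumr; apply: eq_bigr => f _ /=.
    rewrite /E mulrCA; congr (_ * _).
    by rewrite mulr_sumr; apply: eq_bigr => m _; rewrite mulr_sumr.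
  rewrite ler_pdivrMl //.
  apply: (@le_trans _ _ (\sum_(m < M) \sum_(o < A) bound)).
    by do 2 (apply: ler_sum => ? _); apply: mean_error.
  by rewrite !sumr_const !card_ord -mulrnA mulr_natl.
exists (random_code f); apply: (@le_trans _ _ (E f)%:E); last by rewrite lee_fin.
rewrite /error_prob /E EFinM; apply: lee_wpmul2l; first by rewrite lee_fin ltW // invr_gt0.
rewrite -sumEFin; apply: lee_sum => m _.
rewrite big_add1 /= big_mkord -sumEFin; apply: lee_sum => o _.
have T0 : (0 < T)%N by rewrite /T; lia.
have := p_err_fixed star y0 Qch T0 (fun y => erefl : stop (random_code f) y = (size y == T)) m o.+1.
by rewrite law_random_code.
Qed.

End RandomCoding.

(** [good_code] quantifies over all admissible levels; by uniqueness a code built for one level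
    suffices. *)
Lemma async_level_uniq (R : realType) (a eps : R) (N A B : nat) :
  async_level a eps N A -> async_level a eps N B -> A = B.
Proof.
have H A' B' : async_level a eps N A' -> async_level a eps N B' -> (A' <= B')%N.
  by move=> /andP[h1 _] /andP[_ h2]; rewrite -ltnS -(ltr_nat R) -natr1; lra.
by move=> hA hB; apply/eqP; rewrite eqn_leq !H.
Qed.

(** The error is [(N %% K)%:R * v / (K%:R * N%:R)], at most [v / N%:R]. *)
Lemma cvg_divn_ratio (R : realType) (K : nat) (v : R) : (0 < K)%N -> 0 < v ->
  (fun N : nat => (N %/ K)%:R * v / N%:R) @ \oo --> v / K%:R.
Proof.
move=> K0 v0; apply/cvgrPdist_le => e e0.
have b0 : 0 <= v / e by rewrite divr_ge0 // ltW.
exists (Num.bound (v / e)).+1 => // N /= hN.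
have N1 : 1 <= N%:R :> R by rewrite ler1n; apply: leq_trans hN.
have bN : v / e <= N%:R.
  by apply: ltW; apply: lt_le_trans (archi_boundP b0) _; rewrite ler_nat ltnW.
have K0R : 0 < K%:R :> R by rewrite ltr0n.
have E : N%:R = (N %/ K)%:R * K%:R + (N %% K)%:R :> R.
  by rewrite -natrM -natrD -divn_eq.
have r0 : 0 <= (N %% K)%:R :> R by [].
have rK : (N %% K)%:R <= K%:R :> R by rewrite ler_nat ltnW // ltn_mod.
have -> : v / K%:R - (N %/ K)%:R * v / N%:R = (N %% K)%:R * v / (K%:R * N%:R).
  have n0 : N%:R != 0 :> R by rewrite gt_eqF //; lra.
  have -> : (N %/ K)%:R = (N%:R - (N %% K)%:R) / K%:R :> R.
    by rewrite [in RHS]E addrK mulfK // gt_eqF.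
  by field; rewrite n0 gt_eqF.
rewrite ger0_norm; last by rewrite divr_ge0 ?mulr_ge0 // ltW.
rewrite ler_pdivrMr; last by rewrite mulr_gt0 //; lra.
rewrite ler_pdivrMr // in bN.
rewrite mulrCA; apply: ler_pM => //; first exact: ltW.
by rewrite mulrC.
Qed.

(** * Choice of the parameters as the blocklength grows *)

Section Codes.
Variables (R : realType) (X Y : finType) (Q : X -> Y -> R) (star : X).
Hypothesis Qch : is_channel Q.

Lemma exp_nat_le (n j : nat) (gam : R) : (0 < j)%N -> ln 2 <= gam / 2 * j%:R ->
  (2 ^ (n %/ j))%:R <= expR (n%:R * (gam / 2)).
Proof.
move=> j0 hj; rewrite natrX -[X in X ^+ _]lnK ?posrE // -expRM_natl ler_expR.
have l0 : 0 <= ln 2 :> R by rewrite ln_ge0 // ler1n.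
apply: (@le_trans _ _ ((n %/ j)%:R * (gam / 2 * j%:R))).
  by apply: ler_wpM2l.
rewrite mulrCA mulrC; apply: ler_wpM2r.
  have j0R : 0 < j%:R :> R by rewrite ltr0n.
  by rewrite -(pmulr_lge0 _ j0R); apply: le_trans hj.
by rewrite -natrM ler_nat leq_trunc_div.
Qed.

(** A fixed fraction, about [1 / k], of the blocklength carries the message; [k] is large enough for
    the remaining run of [x] to sustain the exponent [a]. *)
Lemma positive_rate_codes (x : X) (a : R) :
  0 < capacity Q -> (a%:E < KL (Q x) (Q star))%E ->
  exists Ms : nat -> nat,
    (exists L : R, 0 < L /\ (fun N : nat => ln (Ms N)%:R / N%:R) @ \oo --> L) /\
    (forall eps : R, 0 < eps -> exists N0 : nat, forall N : nat, (N0 <= N)%N ->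
       exists C : Defs.code X Y N (Ms N), good_code Q star 0 a eps C).
Proof.
move=> cap aKL.
have [y0 _|Y0] := pickP (@predT Y); last first.
  by have := Qch.2 star; rewrite big1 => [/esym/eqP|y]; [rewrite oner_eq0 | have := Y0 y].
have [g [g1 ag]] := KL_dual (Qch.1 x) (Qch.2 x) (Qch.1 star) (Qch.2 star) aKL.
have [P [h [P0 P1 h1 I0]]] := information_density_dual Qch cap.
set K := \sum_y _ in ag; set I := \sum_x _ in I0.
(* Thresholds strictly below the means [K] and [I] of the two scores leave room for the Chernoff
   bounds; [c] also stays above [a]. *)
pose c := (a + K) / 2; pose gam := I / 2.
have ac : a < c by rewrite /c; lra.
have gam0 : 0 < gam by rewrite /gam; lra.
have [lam1 [kap1 [lam10 kap10 /(_ tt) tail1]]] :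
    exists lam kap : R, [/\ 0 < lam, 0 < kap &
    forall i : unit, \sum_b Q x b * expR (- lam * (g b - c)) <= expR (- kap)].
  apply: (@exp_moment_lt1 R unit Y (fun _ => Q x) (fun _ b => g b - c) (K - c)).
  - by rewrite /c; lra.
  - by move=> _ b; apply: Qch.1.
  - by move=> _; apply: Qch.2.
  - move=> _; under eq_bigr do rewrite mulrBr.
    by rewrite sumrB -mulr_suml Qch.2 mul1r.
have [lam2 [kap2 [lam20 kap20 /(_ tt) tail2']]] :
    exists lam kap : R, [/\ 0 < lam, 0 < kap &
    forall i : unit, \sum_(z : X * Y) P z.1 * Q z.1 z.2 * expR (- lam * (h z.1 z.2 - gam)) <= expR (- kap)].
  apply: (@exp_moment_lt1 R unit (X * Y)%type (fun _ z => P z.1 * Q z.1 z.2)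
    (fun _ z => h z.1 z.2 - gam) gam) => //.
  - by move=> _ z; rewrite mulr_ge0 // Qch.1.
  - move=> _; rewrite -(pair_bigA _ (fun x y => P x * Q x y)) /=.
    by under eq_bigr do rewrite -mulr_sumr Qch.2 mulr1.
  - move=> _; rewrite -(pair_bigA _ (fun x y => P x * Q x y * (h x y - gam))) /=.
    have -> : \sum_i \sum_j P i * Q i j * (h i j - gam) = I - gam.
      rewrite -[X in _ = _ - X]mul1r -[X in _ = _ - X * _]P1 mulr_suml -sumrB.
      apply: eq_bigr => i _; under eq_bigr do rewrite mulrBr.
      by rewrite sumrB -mulr_suml -mulr_sumr Qch.2 mulr1.
    by rewrite /gam; lra.
have tail2 : \sum_x P x * \sum_b Q x b * expR (- lam2 * (h x b - gam)) <= expR (- kap2).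
  apply: le_trans tail2'.
  rewrite -(pair_bigA _ (fun x y => P x * Q x y * expR (- lam2 * (h x y - gam)))) /=.
  by apply: ler_sum => i _; rewrite mulr_sumr; apply: ler_sum => b _; rewrite mulrA.
(* Shortening the run by [n2] letters, with [n2 * k <= N], then costs at most [N%:R * (c - a)]. The
   shift [.+2] ensures [k >= 2], hence [n2 <= n1]. *)
pose k := (Num.bound (`|c| / (c - a))).+2.
have k0R : 0 < k%:R :> R by rewrite ltr0n.
have kc : `|c| <= k%:R * (c - a).
  rewrite -ler_pdivrMr ?subr_gt0 //.
  have b0 : 0 <= `|c| / (c - a) by rewrite divr_ge0 // subr_ge0 ltW.
  by apply: ltW; apply: lt_le_trans (archi_boundP b0) _; rewrite ler_nat; apply: leq_trans (leqnSn _) (leqnSn _).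
pose j := (Num.bound (2 * ln 2 / gam)).+1.
have l20 : 0 < ln 2 :> R by rewrite ln_gt0 // ltr1n.
have jg : ln 2 <= gam / 2 * j%:R.
  have b0 : 0 <= 2 * ln 2 / gam by rewrite divr_ge0 ?mulr_ge0 // ltW.
  have : 2 * ln 2 / gam <= j%:R.
    by apply: ltW; apply: lt_le_trans (archi_boundP b0) _; rewrite ler_nat leqnSn.
  rewrite ler_pdivrMr // => ?; lra.
have kj0 : (0 < k * j)%N by rewrite muln_gt0.
(* A power of two makes the limit of the normalized logarithm explicit; [j] keeps the number of
   messages below [expR (n2%:R * (gam / 2))]. *)
exists (fun N => 2 ^ (N %/ (k * j)))%N; split.
  exists (ln 2 / (k * j)%:R); split; first by rewrite divr_gt0 // ltr0n.
  apply: cvg_trans (cvg_divn_ratio kj0 l20); apply: near_eq_cvg; apply: nearW => N.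
  by rewrite natrX lnXn // mulr_natl.
move=> eps eps0.
have e3 : 0 < eps / 3 by lra.
have e9 : 0 < eps / 3 / (3 * k%:R) by rewrite divr_gt0 // mulr_gt0.
have gam20 : 0 < gam / 2 by lra.
have [N1 H1] := poly_expR_small kap10 e3.
have [N2 H2] := poly_expR_small kap20 e3.
have [N3 H3] := poly_expR_small gam20 e9.
(* This makes [n2] itself exceed the three thresholds, and also [j], so that there are at least two
   messages. *)
exists (k * (N1 + N2 + N3 + j))%N => N hN.
pose n2 := (N %/ k)%N; pose n1 := (N - n2)%N.
have hn2 : (N1 + N2 + N3 + j <= n2)%N by rewrite /n2 leq_divRL // mulnC.
have n2N : (n2 <= N)%N by apply: leq_div.
have n2k : (n2 * k <= N)%N by apply: leq_trunc_div.
have NE : (n1 + n2)%N = N by rewrite /n1 subnK.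
have n2n1 : (n2 <= n1)%N.
  by rewrite /n1 leq_subRL // addnn -muln2; apply: leq_trans n2k; rewrite leq_mul2l /k orbT.
have Nk : (N <= k * n2.+1)%N by rewrite mulnC ltnW // ltn_ceil.
rewrite divnMA -/n2; set M := (2 ^ (n2 %/ j))%N.
have M2 : (2 <= M)%N.
  rewrite /M -[X in (X <= _)%N]expn1 leq_exp2l // divn_gt0 //.
  by apply: leq_trans hn2; rewrite leq_addl.
have [A lev] := async_level_exists a eps N.
have /andP[A1 AE] := lev.
have A0R : 0 < A%:R :> R by apply: lt_le_trans AE; apply: expR_gt0.
have A0 : (0 < A)%N by rewrite -(ltr0n R).
have n20 : (0 < n2)%N by apply: leq_trans hn2; rewrite /j addnS.
have [C] := random_coding y0 Qch P0 P1 lam10 lam20 g1 h1 tail1 tail2 n1 n20 A0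
  (Ordinal (ltnW M2)).
move: C; rewrite NE => C err; exists C; split => // B levB.
rewrite -(async_level_uniq lev levB); split.
  by apply: (rate_at_least_nonpos star y0 Qch); [lra | apply: ltnW].
apply: le_trans err _; rewrite lee_fin.
have hM : M%:R <= expR (n2%:R * (gam / 2)) by apply: exp_nat_le.
have h1' := H1 n2 (leq_trans (leq_trans (leq_addr _ _) (leq_trans (leq_addr _ _) (leq_addr _ _))) hn2).
have h2' := H2 n2 (leq_trans (leq_trans (leq_addl _ _) (leq_trans (leq_addr _ _) (leq_addr _ _))) hn2).
have h3' := H3 n2 (leq_trans (leq_trans (leq_addl _ _) (leq_addr _ _)) hn2).
have n2R : 0 <= n2%:R :> R by [].
have t1 : expR (- kap1 * n1%:R) <= eps / 3.
  apply: le_trans h1'; apply: (@le_trans _ _ (expR (- kap1 * n2%:R))).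
    by rewrite ler_expR !mulNr lerN2 ler_pM2l // ler_nat.
  by rewrite ler_peMl ?expR_ge0 // lerDr.
have t2 : expR (- kap2 * n2%:R) <= eps / 3.
  by apply: le_trans h2'; rewrite ler_peMl ?expR_ge0 // lerDr.
have nc : a * N%:R <= n1%:R * c.
  have -> : n1%:R = N%:R - n2%:R :> R by rewrite -NE natrD addrK.
  have f1 : n2%:R * k%:R * (c - a) <= N%:R * (c - a).
    by rewrite ler_pM2r ?subr_gt0 // -natrM ler_nat.
  have f2 : n2%:R * `|c| <= n2%:R * (k%:R * (c - a)) by apply: ler_wpM2l.
  have f3 : n2%:R * c <= n2%:R * `|c| by apply: ler_wpM2l => //; apply: ler_norm.
  lra.
(* The bound for far windows passing the first test sums to at most 1 over the offsets, as
   [n1%:R * c] dominates the asynchronism exponent. *)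
have Aal : (A%:R - 1) * expR (- (n1%:R * c)) <= 1.
  rewrite expRN ler_pdivrMr ?expR_gt0 // mul1r; apply: le_trans (ltW A1) _.
  rewrite ler_expR; apply: le_trans nc; apply: ler_wpM2r => //; lra.
(* Half of the exponent [gam] pays for the number of messages; the other half beats [2 * N + 1],
   which is at most [3 * k * (n2 + 1)]. *)
have t3 : M%:R * (((2 * N)%:R + (A%:R - 1) * expR (- (n1%:R * c))) *
    expR (- (n2%:R * gam))) <= eps / 3.
  have kk : 0 < 3 * k%:R :> R by rewrite mulr_gt0.
  apply: (@le_trans _ _ ((3 * k%:R) * ((n2%:R + 1) * expR (- (gam / 2) * n2%:R)))); last first.
    by rewrite mulrC -ler_pdivlMr.
  have -> : - (gam / 2) * n2%:R = n2%:R * (gam / 2) - n2%:R * gam by field.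
  rewrite expRD [X in X <= _]mulrCA [X in _ <= X]mulrA [X in _ <= X]mulrA.
  rewrite [X in X <= _]mulrA; apply: ler_wpM2r; first exact: expR_ge0.
  have NR : (2 * N)%:R <= 2 * (k%:R * (n2%:R + 1)) :> R.
    by rewrite natr1 -natrM -[X in X * _%:R]/(2%:R) -natrM ler_nat leq_mul2l Nk orbT.
  have k1 : 1 <= k%:R * (n2%:R + 1) :> R by rewrite natr1 -natrM ler1n muln_gt0.
  apply: ler_pM => //; last by lra.
  by rewrite addr_ge0 // mulr_ge0 ?expR_ge0 // subr_ge0 ler1n.
by apply: le_trans (lerD (lerD t1 t2) t3) _; lra.
Qed.

End Codes.

(** Approximation by reals from below also covers an infinite divergence, where the threshold is
    infinite too. *)
Lemma ereal_le_from_below (R : realType) (x y : \bar R) :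
  (forall a : R, (a%:E < x)%E -> (a%:E <= y)%E) -> (x <= y)%E.
Proof.
move=> H; rewrite leNgt; apply/negP; move: H; case: x => [d| |]; case: y => [s| |] H;
  rewrite ?ltNyy ?ltyy ?lte_fin //.
- by move=> sd; have := H ((s + d) / 2); rewrite lte_fin lee_fin; lra.
- have dd : d - 1 < d by lra.
  by move=> _; have := H (d - 1); rewrite lte_fin leNgt ltNyr => /(_ dd).
- by move=> _; have := H (s + 1) (ltry _); rewrite lee_fin; lra.
- by move=> _; have := H 0 (ltry _); rewrite leNgt ltNyr.
Qed.

Unset Implicit Arguments. Set Strict Implicit.

Theorem theorem1 (R : realType) (X Y : finType) (Q : X -> Y -> R) (star : X) :
  is_channel Q ->
  (forall y : Y, exists x : X, 0 < Q x y) ->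
  0 < capacity Q ->
  sync_threshold Q star = (\big[maxe/-oo]_(x : X) KL (Q x) (Q star))%E /\
  (forall a : R, (a%:E < sync_threshold Q star)%E ->
     exists Ms : nat -> nat,
       (exists L : R, 0 < L /\
          (fun N : nat => ln (Ms N)%:R / N%:R) @ \oo --> L) /\
       (forall eps : R, 0 < eps -> exists N0 : nat, forall N : nat, (N0 <= N)%N ->
          exists C : Defs.code X Y N (Ms N), good_code Q star 0 a eps C)).
Proof.
move=> Qch _ cap.
set D := (\big[maxe/-oo]_(x : X) KL (Q x) (Q star))%E.
(* The same codes give the lower bound on the threshold and, once its value is known, the second
   claim. *)
have codes (a : R) : (a%:E < D)%E -> exists Ms : nat -> nat,
    (exists L : R, 0 < L /\ (fun N : nat => ln (Ms N)%:R / N%:R) @ \oo --> L) /\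
    (forall eps : R, 0 < eps -> exists N0 : nat, forall N : nat, (N0 <= N)%N ->
       exists C : Defs.code X Y N (Ms N), good_code Q star 0 a eps C).
  move=> aD; suff [x ax] : exists x, (a%:E < KL (Q x) (Q star))%E.
    exact: (positive_rate_codes Qch cap ax).
  apply: contrapT => /forallNP H; suff : (D <= a%:E)%E by rewrite leNgt aD.
  by apply: bigmax_le => [|x _]; rewrite ?leNye // leNgt; apply/negP.
suff -> : sync_threshold Q star = D by [].
apply/eqP; rewrite eq_le; apply/andP; split.
  by apply: ge_ereal_sup => _ [a ach <-]; apply: achievable_le_KL.
apply: ereal_le_from_below => a /codes[Ms [_ good]].
apply: ereal_sup_ubound; exists a => // eps eps0.
have [N0 HN] := good eps eps0; exists N0 => N /HN[C gC].
by exists (Ms N), C.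
Qed.
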